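(* Let $p_4$, $\mathcal{V}$, $\overline{\mathcal{X}}$ and $g_4$ be as defined in the context. Then $(\boldsymbol{x},\boldsymbol{U},\boldsymbol{V})$ is an optimal solution of $$\min_{(\boldsymbol{x},\boldsymbol{U},\boldsymbol{V})\in\overline{\mathcal{X}}}\ \max_{\boldsymbol{Z}\in\mathcal{V}}\ g_4(\boldsymbol{x},\boldsymbol{U},\boldsymbol{V},\boldsymbol{Z})$$ if and only if there exist $(\boldsymbol{Y},\boldsymbol{R},\boldsymbol{E},\boldsymbol{\lambda})$, consisting of symmetric $n\times n$ matrices $\boldsymbol{Y}^i,\boldsymbol{R}^i$ ($i\in[n]$), $\boldsymbol{Y}^{n+1}$, $\boldsymbol{Y}^{ij},\boldsymbol{E}^{ij}$ ($i\le j\in[n]$), $\boldsymbol{R}^{ij}$ ($i,j\in[n]$) and $\boldsymbol{\lambda}\in\mathbb{R}^m$, such that $(\boldsymbol{x},\boldsymbol{U},\boldsymbol{V},\boldsymbol{Y},\boldsymbol{R},\boldsymbol{E},\boldsymbol{\lambda})$ is an optimal solution of the problem: minimize $-\sum_{l=1}^m\lambda_lq_l$ over $(\boldsymbol{x},\boldsymbol{U},\boldsymbol{V},\boldsymbol{Y},\boldsymbol{R},\boldsymbol{E},\boldsymbol{\lambda})$ subject to (i) for all $i\in[n]$: $$\boldsymbol{Y}^i+\sum_l\lambda_l\boldsymbol{A}_l^i\preceq\boldsymbol{0},\quad\boldsymbol{R}^i+\sum_l\lambda_l\boldsymbol{B}_l^i\preceq\boldsymbol{0},\quad\boldsymbol{U}_i+\sum_l\lambda_l\boldsymbol{c}_l^i=\boldsymbol{0},\quad\boldsymbol{x}-\boldsymbol{U}_i+\sum_l\lambda_l\boldsymbol{d}_l^i=\boldsymbol{0},$$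 $$x_i+\sum_l\lambda_l\mu_l^i=0,\quad1-x_i+\sum_l\lambda_l\nu_l^i=0,\quad\begin{pmatrix}\boldsymbol{Y}^i&\boldsymbol{U}_i\\\boldsymbol{U}_i^T&x_i\end{pmatrix}\succeq\boldsymbol{0},\quad\begin{pmatrix}\boldsymbol{R}^i&\boldsymbol{x}-\boldsymbol{U}_i\\(\boldsymbol{x}-\boldsymbol{U}_i)^T&1-x_i\end{pmatrix}\succeq\boldsymbol{0};$$ (ii) $$\boldsymbol{Y}^{n+1}+\sum_l\lambda_l\boldsymbol{\Xi}_l\preceq\boldsymbol{0},\quad\boldsymbol{x}+\sum_l\lambda_l\boldsymbol{\omega}_l=\boldsymbol{0},\quad1+\sum_l\lambda_l\gamma_l=0,\quad\begin{pmatrix}\boldsymbol{Y}^{n+1}&\boldsymbol{x}\\\boldsymbol{x}^T&1\end{pmatrix}\succeq\boldsymbol{0};$$ (iii) for all $i\le j\in[n]$: $$\boldsymbol{Y}^{ij}+\sum_l\lambda_l\overline{\boldsymbol{A}}_l^{ij}\preceq\boldsymbol{0},\quad\boldsymbol{v}_{ij}+\sum_l\lambda_l\overline{\boldsymbol{c}}_l^{ij}=\boldsymbol{0},\quad u_{ij}+\sum_l\lambda_l\overline{\mu}_l^{ij}=0,\quad\begin{pmatrix}\boldsymbol{Y}^{ij}&\boldsymbol{v}_{ij}\\\boldsymbol{v}_{ij}^T&u_{ij}\end{pmatrix}\succeq\boldsymbol{0};$$ (iv) for all $i,j\in[n]$: $$\boldsymbol{R}^{ij}+\sum_l\lambda_l\overline{\boldsymbol{B}}_l^{ij}\preceq\boldsymbol{0},\quad\boldsymbol{U}_i-\boldsymbol{v}_{ij}+\sum_l\lambda_l\overline{\boldsymbol{d}}_l^{ij}=\boldsymbol{0},\quad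 x_i-u_{ij}+\sum_l\lambda_l\overline{\nu}_l^{ij}=0,\quad\begin{pmatrix}\boldsymbol{R}^{ij}&\boldsymbol{U}_i-\boldsymbol{v}_{ij}\\(\boldsymbol{U}_i-\boldsymbol{v}_{ij})^T&x_i-u_{ij}\end{pmatrix}\succeq\boldsymbol{0};$$ (v) for all $i\le j\in[n]$, with $\boldsymbol{\theta}_{ij}=\boldsymbol{x}-\boldsymbol{U}_i-\boldsymbol{U}_j+\boldsymbol{v}_{ij}$: $$\boldsymbol{E}^{ij}+\sum_l\lambda_l\boldsymbol{C}_l^{ij}\preceq\boldsymbol{0},\quad\boldsymbol{\theta}_{ij}+\sum_l\lambda_l\boldsymbol{e}_l^{ij}=\boldsymbol{0},\quad1-x_i-x_j+u_{ij}+\sum_l\lambda_l\xi_l^{ij}=0,\quad\begin{pmatrix}\boldsymbol{E}^{ij}&\boldsymbol{\theta}_{ij}\\\boldsymbol{\theta}_{ij}^T&1-x_i-x_j+u_{ij}\end{pmatrix}\succeq\boldsymbol{0};$$ (vi) $(\boldsymbol{x},\boldsymbol{U},\boldsymbol{V})\in\overline{\mathcal{X}}$. Here all sums over $l$ run over $l\in[m]$.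
   Context: $[n]=\{1,\dots,n\}$; $\langle\cdot,\cdot\rangle$ is the trace inner product; $\succeq,\preceq$ denote the semidefinite order on symmetric matrices. Polynomial: $p_4$ is a given real polynomial of degree 4 on $\mathbb{R}^n$. Decompositions: a decomposition of $p_4$ is a polynomial identity $$p_4(\boldsymbol{x})=\sum_{i\le j}x_ix_jp_2^{ij}(\boldsymbol{x})+\sum_{i,j=1}^nx_i(1-x_j)q_2^{ij}(\boldsymbol{x})+\sum_{i\le j}(1-x_i)(1-x_j)t_2^{ij}(\boldsymbol{x})+\sum_{i=1}^nx_ip_2^i(\boldsymbol{x})+\sum_{i=1}^n(1-x_i)q_2^i(\boldsymbol{x})+\beta_2(\boldsymbol{x}),$$ with $p_2^{ij}=\boldsymbol{x}^T\boldsymbol{P}^{ij}\boldsymbol{x}+\boldsymbol{x}^T\boldsymbol{r}^{ij}+w^{ij}$, $q_2^{ij}=\boldsymbol{x}^T\boldsymbol{Q}^{ij}\boldsymbol{x}+\boldsymbol{x}^T\boldsymbol{f}^{ij}+g^{ij}$, $t_2^{ij}=\boldsymbol{x}^T\boldsymbol{T}^{ij}\boldsymbol{x}+\boldsymbol{x}^T\boldsymbol{h}^{ij}+s^{ij}$, $p_2^i=\boldsymbol{x}^T\boldsymbol{P}^i\boldsymbol{x}+\boldsymbol{x}^T\boldsymbol{r}^i+w^i$, $q_2^i=\boldsymbol{x}^T\boldsymbol{Q}^i\boldsymbol{x}+\boldsymbol{x}^T\boldsymbol{f}^i+g^i$, $\beta_2=\boldsymbol{x}^T\boldsymbol{P}'\boldsymbol{x}+\boldsymbol{x}^T\boldsymbol{r}'+w'$.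 $\boldsymbol{Z}$ denotes the collection of all these coefficients: symmetric $n\times n$ matrices $\boldsymbol{P}^{ij},\boldsymbol{Q}^{ij},\boldsymbol{T}^{ij},\boldsymbol{P}^i,\boldsymbol{Q}^i,\boldsymbol{P}'$, vectors in $\mathbb{R}^n$ and scalars. Items attached to $p_2^{ij},t_2^{ij}$ are indexed by $i\le j$, items attached to $q_2^{ij}$ by all $i,j$. Matching the coefficients of all monomials gives $m$ linear equations in $\boldsymbol{Z}$, written for $l\in[m]$ as $$\sum_{i\le j}\Big(\langle\overline{\boldsymbol{A}}_l^{ij},\boldsymbol{P}^{ij}\rangle+(\overline{\boldsymbol{c}}_l^{ij})^T\boldsymbol{r}^{ij}+\overline{\mu}_l^{ij}w^{ij}+\langle\boldsymbol{C}_l^{ij},\boldsymbol{T}^{ij}\rangle+(\boldsymbol{e}_l^{ij})^T\boldsymbol{h}^{ij}+\xi_l^{ij}s^{ij}\Big)+\sum_{i,j=1}^n\Big(\langle\overline{\boldsymbol{B}}_l^{ij},\boldsymbol{Q}^{ij}\rangle+(\overline{\boldsymbol{d}}_l^{ij})^T\boldsymbol{f}^{ij}+\overline{\nu}_l^{ij}g^{ij}\Big)$$ $$+\sum_{i=1}^n\Big(\langle\boldsymbol{A}_l^i,\boldsymbol{P}^i\rangle+\langle\boldsymbol{B}_l^i,\boldsymbol{Q}^i\rangle+(\boldsymbol{c}_l^i)^T\boldsymbol{r}^i+(\boldsymbol{d}_l^i)^T\boldsymbol{f}^i+\mu_l^iw^i+\nu_l^ig^i\Big)+\langle\boldsymbol{\Xi}_l,\boldsymbol{P}'\rangle+\boldsymbol{\omega}_l^T\boldsymbol{r}'+\gamma_lw'=q_l,$$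 which defines the data (all coefficient matrices symmetric). $\mathcal{V}$ is the set of all $\boldsymbol{Z}$ satisfying these equations with all of $\boldsymbol{P}^{ij},\boldsymbol{Q}^{ij},\boldsymbol{T}^{ij},\boldsymbol{P}^i,\boldsymbol{Q}^i,\boldsymbol{P}'$ positive semidefinite. Feasible region: $\mathcal{X}=\{\boldsymbol{x}\in\mathbb{R}^n:\boldsymbol{A}\boldsymbol{x}\le\boldsymbol{b},\ \boldsymbol{h}(\boldsymbol{x})\le\boldsymbol{0}\}$, with the components of $\boldsymbol{h}$ proper, closed and convex; it is assumed that $\mathcal{X}\subseteq[0,1]^n$. $\boldsymbol{U}=(u_{ij})$ is a symmetric $n\times n$ matrix with columns $\boldsymbol{U}_i$, linearizing $\boldsymbol{x}\boldsymbol{x}^T$; $\boldsymbol{V}=(\boldsymbol{v}_{ij})$ with $\boldsymbol{v}_{ij}=\boldsymbol{v}_{ji}\in\mathbb{R}^n$, linearizing $u_{ij}\boldsymbol{x}$. $\overline{\mathcal{X}}$ is the convex set of triples $(\boldsymbol{x},\boldsymbol{U},\boldsymbol{V})$, $\boldsymbol{x}\in\mathcal{X}$, described by the constraints of $\mathcal{X}$ together with those obtained by multiplying constraints of $\mathcal{X}$ with each other and linearizing products with the new variables. In particular, $\overline{\mathcal{X}}$ contains $(\boldsymbol{x},\boldsymbol{x}\boldsymbol{x}^T,(x_ix_j\boldsymbol{x})_{ij})$ for all $\boldsymbol{x}\in\mathcal{X}$, and on $\overline{\mathcal{X}}$ one has $u_{ij}\ge0$, $x_i-u_{ij}\ge0$,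 $1-x_i-x_j+u_{ij}\ge0$ for all $i,j$. Relaxed objective: with $$g_3(\boldsymbol{x},\boldsymbol{U},\boldsymbol{Z})=\sum_{i=1}^n\Big[\tfrac1{x_i}\boldsymbol{U}_i^T\boldsymbol{P}^i\boldsymbol{U}_i+\boldsymbol{U}_i^T\boldsymbol{r}^i+w^ix_i+\tfrac1{1-x_i}(\boldsymbol{x}-\boldsymbol{U}_i)^T\boldsymbol{Q}^i(\boldsymbol{x}-\boldsymbol{U}_i)+(\boldsymbol{x}-\boldsymbol{U}_i)^T\boldsymbol{f}^i+(1-x_i)g^i\Big]+\boldsymbol{x}^T\boldsymbol{P}'\boldsymbol{x}+\boldsymbol{x}^T\boldsymbol{r}'+w'$$ and $\boldsymbol{\theta}_{ij}=\boldsymbol{x}-\boldsymbol{U}_i-\boldsymbol{U}_j+\boldsymbol{v}_{ij}$, $$g_4(\boldsymbol{x},\boldsymbol{U},\boldsymbol{V},\boldsymbol{Z})=g_3(\boldsymbol{x},\boldsymbol{U},\boldsymbol{Z})+\sum_{i\le j}\Big[\tfrac1{u_{ij}}\boldsymbol{v}_{ij}^T\boldsymbol{P}^{ij}\boldsymbol{v}_{ij}+\boldsymbol{v}_{ij}^T\boldsymbol{r}^{ij}+u_{ij}w^{ij}\Big]$$ $$+\sum_{i,j=1}^n\Big[\tfrac1{x_i-u_{ij}}(\boldsymbol{U}_i-\boldsymbol{v}_{ij})^T\boldsymbol{Q}^{ij}(\boldsymbol{U}_i-\boldsymbol{v}_{ij})+(\boldsymbol{U}_i-\boldsymbol{v}_{ij})^T\boldsymbol{f}^{ij}+(x_i-u_{ij})g^{ij}\Big]$$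 $$+\sum_{i\le j}\Big[\tfrac1{1-x_i-x_j+u_{ij}}\boldsymbol{\theta}_{ij}^T\boldsymbol{T}^{ij}\boldsymbol{\theta}_{ij}+\boldsymbol{\theta}_{ij}^T\boldsymbol{h}^{ij}+(1-x_i-x_j+u_{ij})s^{ij}\Big].$$ For $\boldsymbol{P}\succeq\boldsymbol{0}$ and $t=0$, $\frac1t\boldsymbol{v}^T\boldsymbol{P}\boldsymbol{v}$ is read as $0$ if $\boldsymbol{v}^T\boldsymbol{P}\boldsymbol{v}=0$ and $+\infty$ otherwise. The inner maximum is understood as a supremum in $(-\infty,+\infty]$. *)

(* Defs.v *)
From HB Require Import structures.
From mathcomp Require Import all_boot all_order all_algebra.
From mathcomp Require Import all_classical all_reals all_analysis.
(* The notations of mpoly clash with those of the analysis library. *)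
From mathcomp Require Export -(notations) mpoly.

Set Implicit Arguments.
Unset Strict Implicit.
Unset Printing Implicit Defensive.

Import Order.TTheory GRing.Theory Num.Theory numFieldNormedType.Exports.

Local Open Scope classical_set_scope.
Local Open Scope ring_scope.

Section Matrices.
Variables (R : realType) (n : nat).

Definition dot (u v : 'cV[R]_n) : R := (u^T *m v) 0 0.

Definition inner (A B : 'M[R]_n) : R := \tr (A^T *m B).

Definition qform (P : 'M[R]_n) (v : 'cV[R]_n) : R := dot v (P *m v).

Definition psd (P : 'M[R]_n) : Prop :=
  P^T = P /\ forall v : 'cV[R]_n, 0 <= qform P v.

Definition loewner_le (A B : 'M[R]_n) : Prop := psd (B - A).

End Matrices.

Section ExtendedFunctions.
Variables (R : realType) (n : nat).

Definition proper_fun (f : 'cV[R]_n -> \bar R) : Prop :=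
  (forall x, f x <> -oo%E) /\ exists x, f x <> +oo%E.

(* R^o is R seen as a module over itself, as required by convex_set. *)
Definition epigraph (f : 'cV[R]_n -> \bar R) : set ('cV[R]_n * R^o) :=
  [set p | (f p.1 <= (p.2 : R)%:E)%E].

Definition closed_fun (f : 'cV[R]_n -> \bar R) : Prop := closed (epigraph f).

Definition convex_fun (f : 'cV[R]_n -> \bar R) : Prop :=
  convex_set (epigraph f).

End ExtendedFunctions.

(* Index pairs i <= j. *)
Notation upair n := {ij : 'I_n * 'I_n | (ij.1 <= ij.2)%N}.

Section Decompositions.
Variables (R : realType) (n : nat).

Definition mvar (i : 'I_n) : mpoly n R := mpolyX R (mnm1 i).

(* The quadratic polynomial x^T P x + x^T r + w. *)
Record quadratic := Quadratic {
  qmx : 'M[R]_n;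
  qvec : 'cV[R]_n;
  qcst : R }.

Definition quadratic_poly (q : quadratic) : mpoly n R :=
  \sum_a \sum_b qmx q a b *: (mvar a * mvar b)
  + \sum_a qvec q a 0 *: mvar a + mpolyC n (qcst q).

(* The collection Z.  The fields hold p_2^{ij}, q_2^{ij}, t_2^{ij}, p_2^i,
   q_2^i and beta_2, in this order; thus qmx (Zxy Z i j) is Q^{ij},
   qvec (Zx Z i) is r^i.  The suffix of a field names the multiplier of the
   quadratic polynomial, x standing for x_i and y for 1 - x_i. *)
Record coefs := Coefs {
  Zxx : upair n -> quadratic;
  Zxy : 'I_n -> 'I_n -> quadratic;
  Zyy : upair n -> quadratic;
  Zx : 'I_n -> quadratic;
  Zy : 'I_n -> quadratic;
  Z1 : quadratic }.

Definition mul_xx (ij : upair n) : mpoly n R :=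
  mvar (val ij).1 * mvar (val ij).2.
Definition mul_xy (i j : 'I_n) : mpoly n R := mvar i * (1 - mvar j).
Definition mul_yy (ij : upair n) : mpoly n R :=
  (1 - mvar (val ij).1) * (1 - mvar (val ij).2).
Definition mul_x (i : 'I_n) : mpoly n R := mvar i.
Definition mul_y (i : 'I_n) : mpoly n R := 1 - mvar i.

Definition decomposition_poly (Z : coefs) : mpoly n R :=
  \sum_(ij : upair n) mul_xx ij * quadratic_poly (Zxx Z ij)
  + \sum_i \sum_j mul_xy i j * quadratic_poly (Zxy Z i j)
  + \sum_(ij : upair n) mul_yy ij * quadratic_poly (Zyy Z ij)
  + \sum_i mul_x i * quadratic_poly (Zx Z i)
  + \sum_i mul_y i * quadratic_poly (Zy Z i)
  + quadratic_poly (Z1 Z).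

(* One equation for each monomial of degree at most 4 in n variables. *)
Definition nb_eqs : nat := #|{: bmultinom n 5}|.

Definition monom (l : 'I_nb_eqs) : multinom n := enum_val l.

(* The coefficient of the l-th monomial in g * (x^T P x + x^T r + w) is
   <data_mx g l, P> + (data_vec g l)^T r + data_cst g l * w.  For instance
   A_l^i, c_l^i, mu_l^i are the data of g = x_i, and Xi_l, omega_l, gamma_l
   those of g = 1. *)
Definition data_mx (g : mpoly n R) (l : 'I_nb_eqs) : 'M[R]_n :=
  \matrix_(a, b) mcoeff (monom l) (g * (mvar a * mvar b)).

Definition data_vec (g : mpoly n R) (l : 'I_nb_eqs) : 'cV[R]_n :=
  \col_a mcoeff (monom l) (g * mvar a).

Definition data_cst (g : mpoly n R) (l : 'I_nb_eqs) : R :=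
  mcoeff (monom l) g.

Definition data_pairing (g : mpoly n R) (l : 'I_nb_eqs) (q : quadratic) : R :=
  inner (data_mx g l) (qmx q) + dot (data_vec g l) (qvec q)
  + data_cst g l * qcst q.

Definition eq_lhs (l : 'I_nb_eqs) (Z : coefs) : R :=
  \sum_(ij : upair n) (data_pairing (mul_xx ij) l (Zxx Z ij)
                       + data_pairing (mul_yy ij) l (Zyy Z ij))
  + \sum_i \sum_j data_pairing (mul_xy i j) l (Zxy Z i j)
  + \sum_i (data_pairing (mul_x i) l (Zx Z i)
            + data_pairing (mul_y i) l (Zy Z i))
  + data_pairing 1 l (Z1 Z).

Definition eq_rhs (p4 : mpoly n R) (l : 'I_nb_eqs) : R := mcoeff (monom l) p4.

Definition psd_coefs (Z : coefs) : Prop :=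
  [/\ forall ij, psd (qmx (Zxx Z ij)),
      forall i j, psd (qmx (Zxy Z i j)),
      forall ij, psd (qmx (Zyy Z ij)),
      forall i, psd (qmx (Zx Z i)) /\ psd (qmx (Zy Z i))
    & psd (qmx (Z1 Z))].

Definition Vset (p4 : mpoly n R) : set coefs :=
  [set Z | (forall l, eq_lhs l Z = eq_rhs p4 l) /\ psd_coefs Z].

Lemma mcoeff_mul_quadratic g l q :
  mcoeff (monom l) (g * quadratic_poly q) = data_pairing g l q.
Proof.
rewrite /quadratic_poly !mulrDr !mcoeffD; congr (_ + _ + _).
- rewrite /inner /mxtrace.
  under [RHS]eq_bigr do rewrite mxE.
  rewrite [RHS]exchange_big mulr_sumr raddf_sum /=; apply: eq_bigr => a _.
  rewrite mulr_sumr raddf_sum /=; apply: eq_bigr => b _.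
  by rewrite !mxE -scalerAr mcoeffZ mulrC.
- rewrite /dot mxE mulr_sumr raddf_sum /=; apply: eq_bigr => a _.
  by rewrite !mxE -scalerAr mcoeffZ mulrC.
- by rewrite mulrC mcoeffCM mulrC.
Qed.

Lemma mcoeff_decomposition_poly l Z :
  mcoeff (monom l) (decomposition_poly Z) = eq_lhs l Z.
Proof.
have sumE (I : finType) (g : I -> mpoly n R) (q : I -> quadratic) :
    mcoeff (monom l) (\sum_i g i * quadratic_poly (q i))
    = \sum_i data_pairing (g i) l (q i).
  by rewrite raddf_sum; apply: eq_bigr => i _; exact: mcoeff_mul_quadratic.
rewrite /decomposition_poly /eq_lhs -[quadratic_poly (Z1 Z)]mul1r.
rewrite (big_split _ _ _ (fun ij => data_pairing (mul_xx ij) l (Zxx Z ij))).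
rewrite (big_split _ _ _ (fun i => data_pairing (mul_x i) l (Zx Z i))) /=.
rewrite 5!mcoeffD mcoeff_mul_quadratic !sumE; congr (_ + _).
rewrite -!addrA; congr (_ + _); rewrite addrCA; congr (_ + (_ + _)).
by rewrite raddf_sum; apply: eq_bigr => i _; exact: sumE.
Qed.

Let msizeM_leq d1 d2 (p q : mpoly n R) :
  (msize p <= d1.+1)%N -> (msize q <= d2.+1)%N ->
  (msize (p * q) <= (d1 + d2).+1)%N.
Proof.
have [->|p0] := eqVneq p 0; first by rewrite mul0r msize0.
have [->|q0] := eqVneq q 0; first by rewrite mulr0 msize0.
rewrite msizeM // => hp hq; rewrite -ltnS prednK; last first.
  by rewrite addn_gt0 lt0n msize_poly_eq0 p0.
by rewrite (leq_trans (leq_add hp hq)) // addSn addnS.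
Qed.

Let msizeD_leq d (p q : mpoly n R) :
  (msize p <= d)%N -> (msize q <= d)%N -> (msize (p + q) <= d)%N.
Proof. by move=> hp hq; rewrite (leq_trans (msizeD_le _ _))// geq_max hp. Qed.

Let msize_sum_leq d (I : finType) (F : I -> mpoly n R) :
  (forall i, (msize (F i) <= d)%N) -> (msize (\sum_i F i) <= d)%N.
Proof.
by move=> hF; elim/big_ind: _ => [|p q|i _]; rewrite ?msize0//; exact: msizeD_leq.
Qed.

Let msize_mvar i : (msize (mvar i) <= 2)%N.
Proof. by rewrite msizeX mdeg1. Qed.

Let msize_mvarC i : (msize (1 - mvar i) <= 2)%N.
Proof. by apply: msizeD_leq; rewrite ?msize1 // msizeN msize_mvar. Qed.

Let msize_quadratic q : (msize (quadratic_poly q) <= 3)%N.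
Proof.
apply: msizeD_leq; first apply: msizeD_leq.
- apply: msize_sum_leq => a; apply: msize_sum_leq => b.
  apply: leq_trans (msizeZ_le _ _) _.
  exact: (@msizeM_leq 1 1 _ _ (msize_mvar _) (msize_mvar _)).
- apply: msize_sum_leq => a; apply: leq_trans (msizeZ_le _ _) _.
  exact: leq_trans (msize_mvar _) _.
- by rewrite msizeC; case: (_ != 0).
Qed.

Let msize_decomposition Z : (msize (decomposition_poly Z) <= 5)%N.
Proof.
have mq2 (g : mpoly n R) q :
    (msize g <= 3)%N -> (msize (g * quadratic_poly q) <= 5)%N.
  by move=> hg; exact: (@msizeM_leq 2 2 _ _ hg (msize_quadratic q)).
have mq1 (g : mpoly n R) q :
    (msize g <= 2)%N -> (msize (g * quadratic_poly q) <= 5)%N.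
  by move=> hg; apply: mq2; exact: leq_trans hg _.
apply: msizeD_leq; last exact: leq_trans (msize_quadratic _) _.
apply: msizeD_leq; last first.
  by apply: msize_sum_leq => i; exact: mq1 (msize_mvarC i).
apply: msizeD_leq; last by apply: msize_sum_leq => i; exact: mq1 (msize_mvar i).
apply: msizeD_leq; last first.
  by apply: msize_sum_leq => ij; apply: mq2; exact: (@msizeM_leq 1 1).
apply: msizeD_leq.
  by apply: msize_sum_leq => ij; apply: mq2; exact: (@msizeM_leq 1 1).
apply: msize_sum_leq => i; apply: msize_sum_leq => j; apply: mq2.
exact: (@msizeM_leq 1 1).
Qed.

(* The equations indeed express the identity of polynomials. *)
Lemma decompositionP (p4 : mpoly n R) (Z : coefs) : (msize p4 <= 5)%N ->
  p4 = decomposition_poly Z <-> forall l, eq_lhs l Z = eq_rhs p4 l.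
Proof.
move=> h4; split=> [-> l|eqZ]; first by rewrite /eq_rhs mcoeff_decomposition_poly.
apply/mpolyP => m; have [m5|m5] := ltnP (mdeg m) 5; last first.
  by rewrite !memN_msupp_eq0 //; apply: msize_mdeg_ge; exact: leq_trans m5.
have := eqZ (enum_rank (BMultinom m5)).
by rewrite -mcoeff_decomposition_poly /eq_rhs /monom enum_rankK.
Qed.

End Decompositions.

Section Region.
Variables (R : realType) (n p K : nat).
Variables (A : 'M[R]_(p, n)) (b : 'cV[R]_p) (h : 'I_K -> 'cV[R]_n -> \bar R).

Definition Xset : set 'cV[R]_n :=
  [set x | (forall k, (A *m x) k 0 <= b k 0) /\ forall k, (h k x <= 0)%E].

(* Triples (x, U, V), V being the family of the vectors v_{ij}. *)
Definition triple : Type :=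
  ('cV[R]_n * 'M[R]_n * {ffun 'I_n * 'I_n -> 'cV[R]_n})%type.

Definition tx (z : triple) : 'cV[R]_n := z.1.1.
Definition tU (z : triple) : 'M[R]_n := z.1.2.
Definition tv (z : triple) (i j : 'I_n) : 'cV[R]_n := z.2 (i, j).

Definition lift_point (x : 'cV[R]_n) : triple :=
  (x, x *m x^T, [ffun ij : 'I_n * 'I_n => (x ij.1 0 * x ij.2 0) *: x]).

(* Linearization of (b_k - a_k^T x) (b_l - a_l^T x), a_k^T being row k of A. *)
Definition linear_product (k l : 'I_p) (z : triple) : R :=
  (b *m b^T - b *m (A *m tx z)^T - (A *m tx z) *m b^T
   + A *m tU z *m A^T) k l.

(* The set of triples cut out by the constraints of X, the symmetry of U and
   V, the pairwise products of the linear constraints, and a family C of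
   further constraints: the linearized products that involve h or more than
   two factors, whose form depends on h and is not fixed. *)
Definition lifted_region (I : Type) (C : I -> set triple) : set triple :=
  [set z | [/\ Xset (tx z),
               (tU z)^T = tU z,
               forall i j, tv z i j = tv z j i,
               forall k l, 0 <= linear_product k l z
             & forall c, C c z]].

(* convex_set refers to the module structure of the product type triple. *)
Definition convex_region (S : set triple) : Prop :=
  convex_set (S : set ('cV[R]_n * 'M[R]_n
                       * {ffun 'I_n * 'I_n -> 'cV[R]_n})%type).

Definition box_products_nonneg (S : set triple) : Prop :=
  forall z, S z -> forall i j : 'I_n,
    [/\ 0 <= tU z i j, 0 <= tx z i 0 - tU z i j
      & 0 <= 1 - tx z i 0 - tx z j 0 + tU z i j].

End Region.

Section Problems.
Variables (R : realType) (n : nat).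
Implicit Types (z : triple R n) (Z : coefs R n).

Definition theta z (i j : 'I_n) : 'cV[R]_n :=
  tx z - col i (tU z) - col j (tU z) + tv z i j.

Definition theta_cst z (i j : 'I_n) : R :=
  1 - tx z i 0 - tx z j 0 + tU z i j.

(* v^T P v / t, with its conventional value at t = 0. *)
Definition perspective (t : R) (P : 'M[R]_n) (v : 'cV[R]_n) : \bar R :=
  if t == 0 then (if qform P v == 0 then 0%E else +oo%E)
  else (t^-1 * qform P v)%:E.

Definition obj_term (t : R) (v : 'cV[R]_n) (q : quadratic R n) : \bar R :=
  (perspective t (qmx q) v + (dot v (qvec q) + t * qcst q)%:E)%E.

Definition g3 z Z : \bar R :=
  (\sum_(i < n) (obj_term (tx z i 0)%R (col i (tU z)) (Zx Z i)
                 + obj_term (1 - tx z i 0)%R (tx z - col i (tU z))%R (Zy Z i))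
   + (qform (qmx (Z1 Z)) (tx z) + dot (tx z) (qvec (Z1 Z))
      + qcst (Z1 Z))%R%:E)%E.

Definition g4 z Z : \bar R :=
  (g3 z Z
   + \sum_(ij : upair n)
       obj_term (tU z (val ij).1 (val ij).2) (tv z (val ij).1 (val ij).2)
                (Zxx Z ij)
   + \sum_(i < n) \sum_(j < n)
       obj_term (tx z i 0 - tU z i j)%R (col i (tU z) - tv z i j)%R (Zxy Z i j)
   + \sum_(ij : upair n)
       obj_term (theta_cst z (val ij).1 (val ij).2)
                (theta z (val ij).1 (val ij).2) (Zyy Z ij))%E.

Definition inner_max (p4 : mpoly n R) z : \bar R :=
  ereal_sup [set g4 z Z | Z in Vset p4].

(* Y^{ij}, R^{ij}, E^{ij}, Y^i, R^i, Y^{n+1} and lambda, in this order. *)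
Record dual_vars := DualVars {
  dYxx : upair n -> 'M[R]_n;
  dRxy : 'I_n -> 'I_n -> 'M[R]_n;
  dEyy : upair n -> 'M[R]_n;
  dYx : 'I_n -> 'M[R]_n;
  dRy : 'I_n -> 'M[R]_n;
  dY1 : 'M[R]_n;
  dlam : 'cV[R]_(nb_eqs n) }.

(* The constraints attached to the multiplier g, for its matrix variable Y.
   Positive semidefiniteness includes the symmetry of Y. *)
Definition dual_block (lam : 'cV[R]_(nb_eqs n)) (g : mpoly n R)
    (Y : 'M[R]_n) (v : 'cV[R]_n) (t : R) : Prop :=
  [/\ loewner_le (Y + \sum_l lam l 0 *: data_mx g l) 0,
      v + \sum_l lam l 0 *: data_vec g l = 0,
      t + \sum_l lam l 0 * data_cst g l = 0
    & psd (block_mx Y v v^T t%:M)].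

Definition sdp_feasible (S : set (triple R n)) : set (triple R n * dual_vars) :=
  [set zd | let: (z, d) := zd in
    [/\ forall i : 'I_n,
          dual_block (dlam d) (mul_x R i) (dYx d i) (col i (tU z)) (tx z i 0)
          /\ dual_block (dlam d) (mul_y R i) (dRy d i)
               (tx z - col i (tU z)) (1 - tx z i 0),
        dual_block (dlam d) 1 (dY1 d) (tx z) 1,
        forall ij : upair n,
          dual_block (dlam d) (mul_xx R ij) (dYxx d ij)
            (tv z (val ij).1 (val ij).2) (tU z (val ij).1 (val ij).2)
          /\ dual_block (dlam d) (mul_yy R ij) (dEyy d ij)
               (theta z (val ij).1 (val ij).2)
               (theta_cst z (val ij).1 (val ij).2),
        forall i j : 'I_n,
          dual_block (dlam d) (mul_xy R i j) (dRxy d i j)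
            (col i (tU z) - tv z i j) (tx z i 0 - tU z i j)
      & S z]].

Definition sdp_obj (p4 : mpoly n R) (zd : triple R n * dual_vars) : R :=
  - \sum_l dlam zd.2 l 0 * eq_rhs p4 l.

End Problems.

Definition optimal_solution (disp : Order.disp_t) (E : porderType disp)
    (T : Type) (S : set T) (f : T -> E) (s : T) : Prop :=
  S s /\ forall s', S s' -> (f s <= f s')%O.

(* Main.v *)
Require Import Defs.
From mathcomp Require Import all_boot all_order all_algebra.
From mathcomp Require Import all_classical all_reals all_analysis.
From mathcomp Require Import ring lra.
Import Order.TTheory GRing.Theory Num.Theory numFieldNormedType.Exports.
Local Open Scope classical_set_scope.
Local Open Scope ring_scope.

(** For a fixed triple [z] of the region, the inner maximum is a conic linear
program in the coefficients [Z] (equations plus semidefinite constraints),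
and the constraints on [(Y, R, E, lambda)] describe its Lagrangian dual.  Both minimization
problems have the same optimal triples because this duality is exact:

- weak duality: every dual feasible [(z, d)] has objective value at least
  [inner_max p4 z] ([weak_duality]);
- strong duality: when [inner_max p4 z] is not [+oo], some dual feasible
  [(z, d)] has objective value at most [inner_max p4 z] ([strong_duality]).

The value [-oo] never occurs.  The value [+oo] does occur, where the dual is
infeasible; but an optimal triple has a finite value, since the lift of
[x] in [X] belongs to the region and has the value [p4(x)]
([inner_max_lift]).

All six families of terms have the same shape: with a multiplier [g] of the
decomposition come a scalar [t] and a vector [v] linearizing [g] and [g x],
and a quadratic polynomial with coefficients [(P, r, w)] contributes
[v^T P v / t + v^T r + t w] to the objective.  The families are therefore
merged into one family indexed by a finite type of blocks.

Weak duality is checked block by block.  The matrix [Y - v v^T / t] is psd (a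
Schur complement), and the trace inner product of psd matrices is nonnegative.

Strong duality rests on a Slater point: [p4] has a decomposition all of whose
matrices are [>= I] ([poly_definite_decomp]).  Any decomposition of [p4] can
be corrected to such a one, because [- g |x|^2] is a sum of blocks with psd
matrices for every multiplier [g].  Indeed [- x_c^2 = x_c (1 - x_c) - x_c],
and [- g |x|^2 = g' |x|^2 - (g + g') |x|^2] passes from one multiplier to the
next.  A Slater point has two consequences.  First, if [t = 0] and [v <> 0] in
some block, then the inner maximum is [+oo]; elsewhere the objective is linear
in [Z].  Secondly, Lagrange multipliers exist ([lagrange_multipliers]).  They
are found one equation at a time, by inserting a number between the slopes of
the objective on the two sides of the hyperplane of the equation.  The
multipliers give [lambda], and [Y = v v^T / t] completes the dual solution. *)

Set Implicit Arguments.
Unset Strict Implicit.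
Unset Printing Implicit Defensive.

(** * Inner products and positive semidefinite matrices *)

Section LinearAlgebra.
Variables (R : realType) (n : nat).
Implicit Types (A B P M : 'M[R]_n) (u v w : 'cV[R]_n).

Lemma dotE u v : dot u v = \sum_a u a 0 * v a 0.
Proof. by rewrite /dot mxE; apply: eq_bigr => a _; rewrite mxE. Qed.

Lemma dotC u v : dot u v = dot v u.
Proof. by rewrite !dotE; apply: eq_bigr => a _; rewrite mulrC. Qed.

Lemma dotDl u v w : dot (u + v) w = dot u w + dot v w.
Proof. by rewrite /dot linearD mulmxDl mxE. Qed.

Lemma dotZl c u v : dot (c *: u) v = c * dot u v.
Proof. by rewrite /dot linearZ -scalemxAl mxE. Qed.

Lemma dotDr u v w : dot u (v + w) = dot u v + dot u w.
Proof. by rewrite /dot mulmxDr mxE. Qed.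

Lemma dotZr c u v : dot u (c *: v) = c * dot u v.
Proof. by rewrite /dot -scalemxAr mxE. Qed.

Lemma dot0l v : dot 0 v = 0.
Proof. by rewrite -(scale0r (0 : 'cV[R]_n)) dotZl mul0r. Qed.

Lemma dot_suml (J : finType) (F : J -> 'cV[R]_n) v :
  dot (\sum_j F j) v = \sum_j dot (F j) v.
Proof.
by rewrite /dot linear_sum mulmx_suml summxE.
Qed.

Lemma dot_delta i v : dot (delta_mx i 0) v = v i 0.
Proof.
rewrite dotE (bigD1 i) //= mxE !eqxx mul1r big1 ?addr0 // => a ai.
by rewrite mxE (negbTE ai) mul0r.
Qed.

Lemma dot_ge0 v : 0 <= dot v v.
Proof. by rewrite dotE; apply: sumr_ge0 => a _; rewrite -expr2 sqr_ge0. Qed.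

Lemma dot_eq0 v : dot v v = 0 -> v = 0.
Proof.
move=> /eqP; rewrite dotE psumr_eq0 => [/allP v0|a _]; last first.
  by rewrite -expr2 sqr_ge0.
apply/colP => a; rewrite mxE; have /= := v0 a (mem_index_enum a).
by rewrite mulf_eq0 orbb => /eqP.
Qed.

Lemma innerE A B : inner A B = \sum_a \sum_b A a b * B a b.
Proof.
rewrite /inner /mxtrace exchange_big /=; apply: eq_bigr => b _.
by rewrite mxE; apply: eq_bigr => a _; rewrite mxE.
Qed.

Lemma innerC A B : inner A B = inner B A.
Proof.
by rewrite !innerE; apply: eq_bigr => a _; apply: eq_bigr => b _; rewrite mulrC.
Qed.

Lemma innerDl A B M : inner (A + B) M = inner A M + inner B M.
Proof. by rewrite /inner linearD mulmxDl linearD. Qed.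

Lemma innerZl c A B : inner (c *: A) B = c * inner A B.
Proof. by rewrite /inner linearZ -scalemxAl linearZ. Qed.

Lemma innerNl A B : inner (- A) B = - inner A B.
Proof. by rewrite -scaleN1r innerZl mulN1r. Qed.

Lemma innerDr A B M : inner M (A + B) = inner M A + inner M B.
Proof. by rewrite !(innerC M) innerDl. Qed.

Lemma innerZr c A B : inner A (c *: B) = c * inner A B.
Proof. by rewrite !(innerC A) innerZl. Qed.

Lemma inner_suml (J : finType) (F : J -> 'M[R]_n) B :
  inner (\sum_j F j) B = \sum_j inner (F j) B.
Proof. by rewrite /inner linear_sum mulmx_suml raddf_sum. Qed.

Lemma dot_mulmxE M u v : dot u (M *m v) = inner M (u *m v^T).
Proof.
rewrite dotE innerE; apply: eq_bigr => a _.
rewrite mxE big_distrr /=; apply: eq_bigr => b _.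
by rewrite !mxE big_ord1 !mxE; ring.
Qed.

Lemma qformE M v : qform M v = inner M (v *m v^T).
Proof. exact: dot_mulmxE. Qed.

Lemma qformDl A B v : qform (A + B) v = qform A v + qform B v.
Proof. by rewrite !qformE innerDl. Qed.

Lemma qformZl c A v : qform (c *: A) v = c * qform A v.
Proof. by rewrite !qformE innerZl. Qed.

Lemma qformZr c A v : qform A (c *: v) = c ^+ 2 * qform A v.
Proof. by rewrite /qform -scalemxAr dotZl dotZr mulrA. Qed.

Lemma qform1 v : qform 1%:M v = dot v v.
Proof. by rewrite /qform mul1mx. Qed.

Lemma qform0 M : qform M 0 = 0.
Proof. by rewrite /qform dot0l. Qed.

Lemma qform_outer u v : qform (u *m u^T) v = dot u v ^+ 2.
Proof.
rewrite /qform -mulmxA /dot mulmxA mxE big_ord1 expr2; congr (_ * _).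
exact: dotC.
Qed.

Lemma outer_sym v : (v *m v^T)^T = v *m v^T.
Proof. by rewrite trmx_mul trmxK. Qed.

Lemma dot_sym P u v : P^T = P -> dot u (P *m v) = dot v (P *m u).
Proof.
move=> Ps; rewrite dotC /dot trmx_mul Ps mulmxA -/(dot _ _).
by [].
Qed.

Lemma qform_shift P u v c : P^T = P ->
  qform P (u + c *: v)
  = qform P u + c *+ 2 * dot u (P *m v) + c ^+ 2 * qform P v.
Proof.
move=> Ps; rewrite /qform mulmxDr -scalemxAr dotDl !dotDr dotZl !dotZr dotZl.
rewrite (dot_sym v u Ps); ring.
Qed.

Lemma psd_sym P : psd P -> P^T = P. Proof. by case. Qed.

Lemma psd_qform P v : psd P -> 0 <= qform P v. Proof. by case. Qed.

Lemma psd0 : psd (0 : 'M[R]_n).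
Proof.
by split=> [|v]; rewrite ?trmx0 // -(scale0r (0 : 'M[R]_n)) qformZl mul0r.
Qed.

Lemma psdD A B : psd A -> psd B -> psd (A + B).
Proof.
move=> [As Ap] [Bs Bp]; split=> [|v]; first by rewrite linearD /= As Bs.
by rewrite qformDl addr_ge0.
Qed.

Lemma psdZ c A : 0 <= c -> psd A -> psd (c *: A).
Proof.
move=> c0 [As Ap]; split=> [|v]; first by rewrite linearZ /= As.
by rewrite qformZl mulr_ge0.
Qed.

Lemma psd_outer v : psd (v *m v^T).
Proof. by split=> [|w]; rewrite ?outer_sym // qform_outer sqr_ge0. Qed.

Lemma psd1 : psd (1%:M : 'M[R]_n).
Proof. by split=> [|v]; rewrite ?trmx1 // qform1 dot_ge0. Qed.

(** The Cauchy-Schwarz inequality of the form [P]. *)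
Lemma psd_cauchy P u v : psd P ->
  dot u (P *m v) ^+ 2 <= qform P u * qform P v.
Proof.
move=> [Ps Pp].
have disc c : 0 <= qform P u + c *+ 2 * dot u (P *m v) + c ^+ 2 * qform P v.
  by rewrite -qform_shift.
move: (Pp u) (Pp v) disc.
move: (dot u _) (qform P u) (qform P v) => B a d a0 d0 disc.
have [d_eq0|d_neq0] := eqVneq d 0.
  have [->|B0] := eqVneq B 0; first by rewrite expr0n mulr_ge0.
  have := disc (- ((a + 1) / (2 * B))).
  have -> : a + - ((a + 1) / (2 * B)) *+ 2 * B
            + (- ((a + 1) / (2 * B))) ^+ 2 * d = - 1 by rewrite d_eq0; field.
  by rewrite lerNr oppr0 ler10.
have d_gt0 : 0 < d by rewrite lt_neqAle eq_sym d_neq0.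
have := disc (- (B / d)).
have -> : a + - (B / d) *+ 2 * B + (- (B / d)) ^+ 2 * d = (a * d - B ^+ 2) / d.
  by field.
by rewrite pmulr_lge0 ?invr_gt0 // subr_ge0.
Qed.

Lemma dot_mul_delta P i v : P^T = P ->
  dot v (P *m delta_mx i 0) = dot (col i P) v.
Proof. by move=> Ps; rewrite -colE dotC. Qed.

Lemma qform_delta P i : qform P (delta_mx i 0) = P i i.
Proof. by rewrite /qform dot_delta -colE mxE. Qed.

(** One step of symmetric Gaussian elimination: it clears row and column [i]
of [P], and a zero diagonal entry stays zero. *)
Lemma psd_pivot P i : psd P -> 0 < P i i ->
  psd (P - (P i i)^-1 *: (col i P *m (col i P)^T)).
Proof.
move=> Ppsd Pii; have Ps := psd_sym Ppsd; split=> [|v].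
  by rewrite linearB /= Ps linearZ /= outer_sym.
rewrite -scaleNr qformDl qformZl qform_outer mulNr subr_ge0.
rewrite mulrC ler_pdivrMr // mulrC -qform_delta -(dot_mul_delta i v Ps).
by rewrite (dot_sym _ _ Ps) psd_cauchy.
Qed.

Lemma psd_diag0 P i j : psd P -> P i i = 0 -> P i j = 0.
Proof.
move=> Ppsd Pii; have := psd_cauchy (delta_mx i 0) (delta_mx j 0) Ppsd.
rewrite qform_delta Pii mul0r dot_delta -colE mxE => h.
by apply/eqP; rewrite -sqrf_eq0 eq_le h sqr_ge0.
Qed.

(** Induction on the number of nonzero diagonal entries of [P]: a pivot splits
off a rank one matrix [c u u^T], on which the inner product is [c u^T M u]. *)
Lemma inner_psd_ge0 M P : psd M -> psd P -> 0 <= inner M P.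
Proof.
move=> Mpsd; move: {2}(_.+1) (ltnSn #|[pred i | P i i != 0]|) => N.
elim: N P => // N IH P; rewrite ltnS => leN Ppsd.
have [/existsP[i Pii]|] := boolP [exists i, P i i != 0]; last first.
  rewrite negb_exists => /forallP d0.
  suff -> : P = 0 by rewrite innerC -(scale0r (0 : 'M[R]_n)) innerZl mul0r.
  apply/matrixP => i j; rewrite mxE; apply: psd_diag0 => //.
  exact/eqP/negbNE.
have Pi0 : 0 < P i i by rewrite lt_neqAle eq_sym Pii -qform_delta psd_qform.
set P' := P - (P i i)^-1 *: (col i P *m (col i P)^T).
have P'psd : psd P' by exact: psd_pivot.
have -> : P = P' + (P i i)^-1 *: (col i P *m (col i P)^T) by rewrite subrK.
rewrite innerDr innerZr -qformE addr_ge0 //; last first.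
  by rewrite mulr_ge0 ?psd_qform // invr_ge0 ltW.
apply: IH => //; apply: leq_trans leN; apply: proper_card.
apply/properP; split.
  apply/fintype.subsetP => j; rewrite !inE; apply: contraNN => /eqP Pj0.
  rewrite /P' !mxE big_ord1 !mxE (psd_diag0 i Ppsd Pj0) Pj0.
  by rewrite mul0r mulr0 subr0.
exists i; rewrite !inE // /P' !mxE big_ord1 !mxE mulrA mulVf // mul1r subrr.
by rewrite eqxx.
Qed.

Lemma qform_bound M : exists2 c, 0 <= c & forall v, `|qform M v| <= c * dot v v.
Proof.
exists (\sum_a \sum_b `|M a b|).
  by apply: sumr_ge0 => a _; apply: sumr_ge0 => b _.
move=> v; rewrite qformE innerE mulr_suml.
apply: le_trans (ler_norm_sum _ _ _) _; apply: ler_sum => a _.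
rewrite mulr_suml; apply: le_trans (ler_norm_sum _ _ _) _.
apply: ler_sum => b _; rewrite normrM ler_wpM2l // !mxE big_ord1 !mxE.
have le_dot c : v c 0 ^+ 2 <= dot v v.
  rewrite dotE (bigD1 c) //= -expr2 lerDl.
  by apply: sumr_ge0 => e _; rewrite -expr2 sqr_ge0.
have := le_dot a; have := le_dot b; move: (v a 0) (v b 0) (dot v v) => x y d.
move=> yd xd; rewrite ler_norml; apply/andP; split.
  by have := sqr_ge0 (x + y); rewrite sqrrD => h; lra.
by have := sqr_ge0 (x - y); rewrite sqrrB => h; lra.
Qed.

End LinearAlgebra.

Section SchurComplement.
Variables (R : realType) (n : nat).
Implicit Types (Y : 'M[R]_n) (v a : 'cV[R]_n) (t : R).

Lemma qform_block Y v t a (c : 'cV[R]_1) :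
  qform (block_mx Y v v^T t%:M) (col_mx a c)
  = qform Y a + c 0 0 *+ 2 * dot v a + t * c 0 0 ^+ 2.
Proof.
have dot_col m (x y : 'cV[R]_n) (w w' : 'cV[R]_m) :
    dot (col_mx x w) (col_mx y w') = dot x y + dot w w'.
  by rewrite /dot tr_col_mx mul_row_col mxE.
rewrite /qform mul_block_col dot_col dotDr mul_scalar_mx.
have -> : v *m c = c 0 0 *: v.
  by apply/colP => i; rewrite !mxE big_ord1 mulrC.
have -> : dot c (v^T *m a + t *: c) = c 0 0 * (dot v a + t * c 0 0).
  by rewrite dotE big_ord1 /dot !mxE.
by rewrite dotZr (dotC a v); ring.
Qed.

Lemma block_sym Y v t : Y^T = Y ->
  (block_mx Y v v^T t%:M)^T = block_mx Y v v^T (t%:M : 'M[R]_1).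
Proof. by move=> Ys; rewrite tr_block_mx trmxK tr_scalar_mx Ys. Qed.

(** The convention [0^-1 = 0] makes the formula cover [t = 0] as well. *)
Lemma psd_block_outer v t : 0 <= t -> (t = 0 -> v = 0) ->
  psd (block_mx (t^-1 *: (v *m v^T)) v v^T (t%:M : 'M[R]_1)).
Proof.
move=> t0 tv; split; first by rewrite block_sym // linearZ /= outer_sym.
move=> w; rewrite -(vsubmxK w) qform_block qformZl qform_outer.
move: (usubmx w) (dsubmx w 0 0) => a c.
have [t_eq0|tn0] := eqVneq t 0.
  by rewrite t_eq0 tv // !dot0l expr0n !mulr0 mul0r !addr0.
have -> : t^-1 * dot v a ^+ 2 + c *+ 2 * dot v a + t * c ^+ 2
          = t^-1 * (dot v a + t * c) ^+ 2 by field.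
by rewrite mulr_ge0 ?invr_ge0 // sqr_ge0.
Qed.

Section PsdBlock.
Variables (Y : 'M[R]_n) (v : 'cV[R]_n) (t : R).
Hypothesis Mpsd : psd (block_mx Y v v^T (t%:M : 'M[R]_1)).

Lemma psd_block_ul : psd Y.
Proof.
have [Ms Mp] := Mpsd; split=> [|a].
  by move: Ms; rewrite tr_block_mx => /eq_block_mx[].
have := Mp (col_mx a 0); rewrite qform_block mxE.
by rewrite mul0rn mul0r expr0n mulr0 !addr0.
Qed.

Lemma psd_block_ge0 : 0 <= t.
Proof.
have := psd_qform (col_mx 0 1%:M) Mpsd.
by rewrite qform_block qform0 mxE dotC dot0l mulr0 !add0r expr1n mulr1.
Qed.

Lemma psd_block_cauchy a : dot v a ^+ 2 <= t * qform Y a.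
Proof.
have := psd_cauchy (col_mx 0 1%:M) (col_mx a 0) Mpsd.
rewrite !qform_block qform0 !mxE (dotC v 0) dot0l.
rewrite mul0rn mul0r expr0n expr1n !mulr0 !addr0 !add0r mulr1.
rewrite mul_block_col !mulmx0 !addr0 /dot tr_col_mx mul_row_col trmx0 mul0mx.
by rewrite add0r trmx1 mul1mx.
Qed.

Lemma psd_block_vec0 : t = 0 -> v = 0.
Proof.
move=> t0; apply: dot_eq0; have := psd_block_cauchy v.
by rewrite t0 mul0r => h; apply/eqP; rewrite -sqrf_eq0 eq_le h sqr_ge0.
Qed.

(** For [t = 0] the subtracted term vanishes, as [0^-1 = 0]. *)
Lemma psd_block_schur : psd (Y - t^-1 *: (v *m v^T)).
Proof.
have [Ys Yp] := psd_block_ul; split=> [|a].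
  by rewrite linearB /= Ys linearZ /= outer_sym.
rewrite -scaleNr qformDl qformZl qform_outer mulNr subr_ge0.
have [t_eq0|tn0] := eqVneq t 0; first by rewrite t_eq0 invr0 mul0r.
rewrite mulrC ler_pdivrMr ?(mulrC _ t) ?psd_block_cauchy //.
by rewrite lt_neqAle eq_sym tn0 psd_block_ge0.
Qed.

End PsdBlock.
End SchurComplement.

(** * Lagrange multipliers for affine equations *)

Section Multipliers.
Variables (R : realType) (E : lmodType R).
Implicit Types (S : set E) (f l : E -> R).

(** Only combinations on lines are required; [a] is any scalar. *)
Definition affine f := forall a x y,
  f (a *: x + (1 - a) *: y) = a * f x + (1 - a) * f y.

Definition convex_subset S := forall a x y, 0 <= a <= 1 ->
  S x -> S y -> S (a *: x + (1 - a) *: y).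

(** [x0] is in the relative algebraic interior of [S]: each segment of [S] that
ends at [x0] can be prolonged beyond [x0] within [S]. *)
Definition relint_point S x0 := S x0 /\ forall x, S x ->
  exists2 a, 1 < a & S (a *: x0 + (1 - a) *: x).

Lemma affineD f l c : affine f -> affine l -> affine (fun x => f x + c * l x).
Proof. by move=> fa la a x y; rewrite fa la; ring. Qed.

(** One equation [l = 0].  Unless [l] vanishes on [S], it takes both signs on
[S]; the convexity of [S] then puts every slope [(f - s) / l] from the side
[l > 0] below every slope from the side [l < 0], and minus the supremum of the
former is a multiplier. *)
Lemma multiplier1 S x0 f l s : convex_subset S -> relint_point S x0 ->
  affine f -> affine l -> l x0 = 0 ->
  (forall x, S x -> l x = 0 -> f x <= s) ->
  exists c, forall x, S x -> f x + c * l x <= s.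
Proof.
move=> Scvx [Sx0 Sint] fa la lx0 fs.
have reflect x : S x -> l x != 0 -> exists2 y, S y & l x * l y < 0.
  move=> Sx lx; have [a a1 Sa] := Sint _ Sx.
  exists (a *: x0 + (1 - a) *: x) => //.
  rewrite la lx0 mulr0 add0r mulrCA -expr2 nmulr_rlt0 ?subr_lt0 //.
  by rewrite exprn_even_gt0.
have slope x y : S x -> S y -> 0 < l x -> l y < 0 ->
    (f x - s) / l x <= (f y - s) / l y.
  move=> Sx Sy lx ly; set d := l x - l y.
  have d0 : 0 < d by rewrite /d subr_gt0 (lt_trans ly).
  have dn0 : d != 0 by rewrite gt_eqF.
  (* The weight for which the combination of x and y lies on l = 0. *)
  set a := - l y / d.
  have a01 : 0 <= a <= 1.
    apply/andP; split; first by rewrite /a divr_ge0 // ?oppr_ge0 ltW.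
    by rewrite /a ler_pdivrMr // mul1r /d lerDr ltW.
  have a1E : 1 - a = l x / d by rewrite /a /d; field.
  have lz : l (a *: x + (1 - a) *: y) = 0 by rewrite la a1E /a; field.
  have := fs _ (Scvx _ _ _ a01 Sx Sy) lz.
  rewrite fa a1E /a => h.
  have {}h : - l y * f x + l x * f y <= s * d.
    rewrite -(ler_pdivrMr _ _ d0); apply: le_trans h.
    rewrite le_eqVlt; apply/orP; left.
    by apply/eqP; field.
  rewrite ler_pdivrMr // mulrAC ler_ndivlMr //; rewrite /d in h; nra.
have [[x [Sx lx]]|/forallNP l0] := pselect (exists x, S x /\ l x != 0);
  last first.
  exists 0 => x Sx; rewrite mul0r addr0; apply: fs => //.
  by apply/eqP; apply: contrapT => /negP lx; apply: (l0 x).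
have [[x1 Sx1 lx1] [x2 Sx2 lx2]] :
    (exists2 x, S x & 0 < l x) /\ (exists2 x, S x & l x < 0).
  have [y Sy] := reflect _ Sx lx.
  have [lx_gt0|lx_lt0|/eqP] := ltgtP (l x) 0; last by rewrite (negbTE lx).
    by rewrite nmulr_rlt0 // => ly; split; [exists y|exists x].
  by rewrite pmulr_rlt0 // => ly; split; [exists x|exists y].
pose A := [set (f x - s) / l x | x in [set x | S x /\ 0 < l x]].
have A0 : A !=set0 by exists ((f x1 - s) / l x1), x1.
have ubA y : S y -> l y < 0 -> ubound A ((f y - s) / l y).
  by move=> Sy ly _ [w [Sw lw] <-]; exact: slope.
exists (- sup A) => y Sy; have [ly|ly|ly] := ltgtP (l y) 0.
- have := @ge_sup _ A _ A0 (ubA _ Sy ly).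
  by rewrite ler_ndivlMr // => h; lra.
- have : (f y - s) / l y <= sup A.
    by apply: ub_le_sup; [exists ((f x2 - s) / l x2); exact: ubA|exists y].
  by rewrite ler_pdivrMr // => h; lra.
- by rewrite ly mulr0 addr0; exact: fs.
Qed.

(** Strong Lagrangian duality under a Slater condition.  The multiplier of the
first equation is found on the part of [S] cut out by the other ones. *)
Lemma lagrange_multipliers S x0 m (l : 'I_m -> E -> R) f s :
  convex_subset S -> relint_point S x0 ->
  affine f -> (forall i, affine (l i)) -> (forall i, l i x0 = 0) ->
  (forall x, S x -> (forall i, l i x = 0) -> f x <= s) ->
  exists c : 'I_m -> R, forall x, S x -> f x + \sum_i c i * l i x <= s.
Proof.
elim: m l f => [|m IH] l f Scvx Sint fa la lx0 fs.
  by exists (fun=> 0) => x Sx; rewrite big_ord0 addr0; apply: fs => // -[].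
pose S' := [set x | S x /\ forall i : 'I_m, l (lift ord0 i) x = 0].
have [c0 hc0] : exists c, forall x, S' x -> f x + c * l ord0 x <= s.
  apply: (@multiplier1 S' x0) => //.
  - move=> a x y a01 [Sx lx] [Sy ly]; split; first exact: Scvx.
    by move=> i; rewrite la lx ly !mulr0 addr0.
  - split=> [|x [Sx lx]]; first by split=> //; case: Sint.
    have [_ /(_ _ Sx)[a a1 Sa]] := Sint; exists a => //; split=> // i.
    by rewrite la lx lx0 !mulr0 addr0.
  - move=> x [Sx lx] l0x; apply: fs => // i.
    by case: (unliftP ord0 i) => [j|] ->.
have [||||c hc] := IH (fun i => l (lift ord0 i))
    (fun x => f x + c0 * l ord0 x) Scvx Sint => //.
- exact: affineD.
- by move=> x Sx lx; exact: hc0.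
exists (fun i => if unlift ord0 i is Some j then c j else c0) => x Sx.
rewrite big_ord_recl unlift_none addrA.
by under eq_bigr do rewrite liftK; exact: hc.
Qed.
End Multipliers.

(** * The blocks of a decomposition *)

(** Index type of all the quadratic polynomials of a decomposition, in the
order [p_2^{ij}], [q_2^{ij}], [t_2^{ij}], [p_2^i], [q_2^i], [beta_2]. *)
Definition block (n : nat) : finType :=
  (upair n + 'I_n * 'I_n + upair n + 'I_n + 'I_n + unit)%type.

Section Blocks.
Variables (R : realType) (n : nat).

Definition blk_xx (ij : upair n) : block n := inl (inl (inl (inl (inl ij)))).
Definition blk_xy (ij : 'I_n * 'I_n) : block n :=
  inl (inl (inl (inl (inr ij)))).
Definition blk_yy (ij : upair n) : block n := inl (inl (inl (inr ij))).
Definition blk_x (i : 'I_n) : block n := inl (inl (inr i)).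
Definition blk_y (i : 'I_n) : block n := inl (inr i).
Definition blk_1 : block n := inr tt.

Definition on_blocks (T : Type) (fxx : upair n -> T) (fxy : 'I_n -> 'I_n -> T)
    (fyy : upair n -> T) (fx fy : 'I_n -> T) (f1 : T) (k : block n) : T :=
  match k with
  | inl (inl (inl (inl (inl ij)))) => fxx ij
  | inl (inl (inl (inl (inr ij)))) => fxy ij.1 ij.2
  | inl (inl (inl (inr ij))) => fyy ij
  | inl (inl (inr i)) => fx i
  | inl (inr i) => fy i
  | inr _ => f1
  end.

Lemma forall_block (P : block n -> Prop) :
  (forall ij, P (blk_xx ij)) -> (forall i j, P (blk_xy (i, j))) ->
  (forall ij, P (blk_yy ij)) -> (forall i, P (blk_x i)) ->
  (forall i, P (blk_y i)) -> P blk_1 -> forall k, P k.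
Proof.
move=> hxx hxy hyy hx hy h1; case=> [[[[[ij|[i j]]|ij]|i]|i]|[]].
- exact: hxx.
- exact: hxy.
- exact: hyy.
- exact: hx.
- exact: hy.
- exact: h1.
Qed.

Lemma big_block (T : Type) (idx : T) (op : Monoid.com_law idx)
    (F : block n -> T) :
  \big[op/idx]_k F k =
  op (op (op (op (op (\big[op/idx]_ij F (blk_xx ij))
                     (\big[op/idx]_i \big[op/idx]_j F (blk_xy (i, j))))
                 (\big[op/idx]_ij F (blk_yy ij)))
             (\big[op/idx]_i F (blk_x i)))
         (\big[op/idx]_i F (blk_y i))) (F blk_1).
Proof.
rewrite !big_sumType /= (big_pred1 tt) //.
rewrite pair_bigA /=.
by congr (op (op (op (op (op _ _) _) _) _) _); apply: eq_bigr => -[].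
Qed.

(** The multiplier of a block in the decomposition. *)
Definition bmul : block n -> mpoly n R :=
  on_blocks (@mul_xx R n) (@mul_xy R n) (@mul_yy R n) (@mul_x R n)
    (@mul_y R n) 1.

Definition bcoef (Z : coefs R n) : block n -> quadratic R n :=
  on_blocks (Zxx Z) (Zxy Z) (Zyy Z) (Zx Z) (Zy Z) (Z1 Z).

(** The linearization at [z] of the multiplier [g] of a block. *)
Definition bcst (z : triple R n) : block n -> R :=
  on_blocks (fun ij => tU z (val ij).1 (val ij).2)
    (fun i j => tx z i 0 - tU z i j)
    (fun ij => theta_cst z (val ij).1 (val ij).2)
    (fun i => tx z i 0) (fun i => 1 - tx z i 0) 1.

(** The linearization at [z] of [g x], for [g] the multiplier of a block. *)
Definition bvec (z : triple R n) : block n -> 'cV[R]_n :=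
  on_blocks (fun ij => tv z (val ij).1 (val ij).2)
    (fun i j => col i (tU z) - tv z i j)
    (fun ij => theta z (val ij).1 (val ij).2)
    (fun i => col i (tU z)) (fun i => tx z - col i (tU z)) (tx z).

Definition bdual (d : dual_vars R n) : block n -> 'M[R]_n :=
  on_blocks (dYxx d) (dRxy d) (dEyy d) (dYx d) (dRy d) (dY1 d).

Definition coefs_of (F : block n -> quadratic R n) : coefs R n :=
  Coefs (fun ij => F (blk_xx ij)) (fun i j => F (blk_xy (i, j)))
    (fun ij => F (blk_yy ij)) (fun i => F (blk_x i)) (fun i => F (blk_y i))
    (F blk_1).

Lemma coefs_ofK F : bcoef (coefs_of F) =1 F.
Proof. exact: forall_block. Qed.

Definition dual_of (F : block n -> 'M[R]_n) (lam : 'cV[R]_(nb_eqs n)) :=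
  DualVars (fun ij => F (blk_xx ij)) (fun i j => F (blk_xy (i, j)))
    (fun ij => F (blk_yy ij)) (fun i => F (blk_x i)) (fun i => F (blk_y i))
    (F blk_1)
    lam.

Lemma dual_ofK F lam : bdual (dual_of F lam) =1 F.
Proof. exact: forall_block. Qed.

Lemma decomposition_polyE Z :
  decomposition_poly Z = \sum_k bmul k * quadratic_poly (bcoef Z k).
Proof. by rewrite big_block /= mul1r. Qed.

Lemma eq_lhsE l Z :
  eq_lhs l Z = \sum_k data_pairing (bmul k) l (bcoef Z k).
Proof. by rewrite big_block /= /eq_lhs !big_split /=; ring. Qed.

Lemma psd_coefsE Z : psd_coefs Z <-> forall k, psd (qmx (bcoef Z k)).
Proof.
split=> [[hxx hxy hyy hxhy h1]|h].
  by apply: forall_block => //= i; case: (hxhy i).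
split=> [ij|i j|ij|i|]; [exact: (h (blk_xx ij))|exact: (h (blk_xy (i, j)))|
  exact: (h (blk_yy ij))| |exact: (h blk_1)].
by split; [exact: (h (blk_x i))|exact: (h (blk_y i))].
Qed.

Lemma sdp_feasibleE (S : set (triple R n)) z d :
  sdp_feasible S (z, d) <-> S z /\ forall k,
    dual_block (dlam d) (bmul k) (bdual d k) (bvec z k) (bcst z k).
Proof.
split=> [[hi h1 hij hxy Sz]|[Sz h]].
  split=> //; apply: forall_block => //=.
  - by move=> ij; case: (hij ij).
  - by move=> ij; case: (hij ij).
  - by move=> i; case: (hi i).
  - by move=> i; case: (hi i).
split=> // [i||ij|i j].
- by split; [exact: (h (blk_x i))|exact: (h (blk_y i))].
- exact: (h blk_1).
- by split; [exact: (h (blk_xx ij))|exact: (h (blk_yy ij))].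
- exact: (h (blk_xy (i, j))).
Qed.

Lemma obj_term1 v (q : quadratic R n) :
  obj_term 1 v q = (qform (qmx q) v + dot v (qvec q) + qcst q)%:E.
Proof.
by rewrite /obj_term /perspective oner_eq0 invr1 !mul1r -EFinD addrA.
Qed.

Lemma g4E z Z : g4 z Z = (\sum_k obj_term (bcst z k) (bvec z k) (bcoef Z k))%E.
Proof.
rewrite big_block /= obj_term1 /g4 /g3 big_split /=.
by rewrite -addeA -addeA addeC !addeA.
Qed.

End Blocks.

(** * Decompositions with definite matrices *)

Lemma ffun_addE (T : finType) (V : nmodType) (f g : {ffun T -> V}) k :
  (f + g) k = f k + g k.
Proof. by rewrite ffunE. Qed.

Lemma ffun_scaleE (T : finType) (R : pzRingType) (V : lmodType R) c
    (f : {ffun T -> V}) k : (c *: f) k = c *: f k.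
Proof. by rewrite ffunE. Qed.

Section Slater.
Variables (R : realType) (n : nat).
Implicit Types (D : set 'M[R]_n) (p f g : mpoly n R).

(** Coefficients [(P, r, w)] of a quadratic polynomial, as a vector space. *)
Definition qspace : lmodType R := ('M[R]_n * 'cV[R]_n * R^o)%type.

Definition qmat (q : qspace) : 'M[R]_n := q.1.1.

Definition quad (q : qspace) : quadratic R n :=
  Quadratic (qmat q) q.1.2 (q.2 : R).

(** The collections of coefficients of a decomposition, as a vector space. *)
Definition family : lmodType R := {ffun block n -> qspace}.

Lemma qmatD q q' : qmat (q + q') = qmat q + qmat q'.
Proof. by []. Qed.

Lemma qmatZ c q : qmat (c *: q) = c *: qmat q.
Proof. by []. Qed.

Lemma family0 k : (0 : family) k = 0.
Proof. by rewrite -(scale0r (0 : family)) ffun_scaleE scale0r. Qed.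

Lemma familyD (F G : family) k : (F + G) k = F k + G k.
Proof. exact: ffun_addE. Qed.

Lemma familyZ c (F : family) k : (c *: F) k = c *: F k.
Proof. exact: ffun_scaleE. Qed.

Definition qpoly (q : qspace) : mpoly n R := quadratic_poly (quad q).

Lemma qpolyD q q' : qpoly (q + q') = qpoly q + qpoly q'.
Proof.
rewrite /qpoly /quadratic_poly /= mpolyCD.
under eq_bigr do under eq_bigr do rewrite mxE scalerDl.
under eq_bigr do rewrite big_split /=.
rewrite big_split /=; under [X in _ + X + _ = _]eq_bigr do rewrite mxE scalerDl.
rewrite big_split /=; ring.
Qed.

Lemma qpolyZ c q : qpoly (c *: q) = c *: qpoly q.
Proof.
rewrite /qpoly /quadratic_poly /= !scalerDr; congr (_ + _ + _).
- rewrite scaler_sumr; apply: eq_bigr => a _.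
  by rewrite scaler_sumr; apply: eq_bigr => b _; rewrite mxE scalerA.
- by rewrite scaler_sumr; apply: eq_bigr => a _; rewrite mxE scalerA.
- by rewrite mpolyCM mul_mpolyC.
Qed.

Lemma qpoly_mx P : qpoly (P, 0, 0) =
  \sum_a \sum_b P a b *: (mvar R a * mvar R b).
Proof.
rewrite /qpoly /quadratic_poly /= mpolyC0 addr0.
by rewrite [X in _ + X]big1 ?addr0 // => a _; rewrite mxE scale0r.
Qed.

Lemma qpoly_vec v : qpoly (0, v, 0) = \sum_a v a 0 *: mvar R a.
Proof.
rewrite /qpoly /quadratic_poly /= mpolyC0 addr0 big1 ?add0r // => a _.
by rewrite big1 // => b _; rewrite mxE scale0r.
Qed.

Lemma qpoly_cst c : qpoly (0, 0, c) = mpolyC n c.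
Proof.
rewrite /qpoly /quadratic_poly /= [X in X + _ + _]big1 => [|a _]; last first.
  by rewrite big1 // => b _; rewrite mxE scale0r.
by rewrite add0r big1 ?add0r // => a _; rewrite mxE scale0r.
Qed.

Lemma qpoly0 : qpoly 0 = 0.
Proof. by rewrite -(scale0r (0 : qspace)) qpolyZ scale0r. Qed.

(** The polynomial decomposed by the family [F]. *)
Definition decomp (F : family) : mpoly n R := \sum_k bmul R k * qpoly (F k).

Lemma decompD F G : decomp (F + G) = decomp F + decomp G.
Proof.
rewrite /decomp; under eq_bigr do rewrite familyD qpolyD mulrDr.
exact: big_split.
Qed.

Lemma decompZ c F : decomp (c *: F) = c *: decomp F.
Proof.
rewrite /decomp scaler_sumr; apply: eq_bigr => k _.
by rewrite familyZ qpolyZ scalerAr.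
Qed.

(** [f] has a decomposition all of whose matrices belong to [D]. *)
Definition decomp_with D f :=
  exists2 F : family, (forall k, D (qmat (F k))) & f = decomp F.

Section DecompWith.
Variable D : set 'M[R]_n.
Hypotheses (D0 : D 0) (DD : forall A B, D A -> D B -> D (A + B)).

Lemma decomp_withD f g :
  decomp_with D f -> decomp_with D g -> decomp_with D (f + g).
Proof.
move=> [F FD ->] [G GD ->]; exists (F + G); rewrite ?decompD // => k.
by rewrite familyD qmatD; exact: DD.
Qed.

Lemma decomp_withZ c f : (forall A, D A -> D (c *: A)) ->
  decomp_with D f -> decomp_with D (c *: f).
Proof.
move=> DZ [F FD ->]; exists (c *: F); rewrite ?decompZ // => k.
by rewrite familyZ qmatZ; exact: DZ.
Qed.

Lemma decomp_with_block k q : D (qmat q) -> decomp_with D (bmul R k * qpoly q).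
Proof.
move=> Dq; exists [ffun j => if j == k then q else 0].
  by move=> j; rewrite ffunE; case: ifP.
rewrite /decomp (bigD1 k) //= ffunE eqxx big1 ?addr0 // => j jk.
by rewrite ffunE (negbTE jk) qpoly0 mulr0.
Qed.

Lemma decomp_with0 : decomp_with D 0.
Proof.
by rewrite -(mulr0 (bmul R (blk_1 n))) -qpoly0; exact: decomp_with_block.
Qed.

Lemma decomp_with_sum (J : Type) (r : seq J) (P : pred J) (f : J -> mpoly n R) :
  (forall j, P j -> decomp_with D (f j)) ->
  decomp_with D (\sum_(j <- r | P j) f j).
Proof.
move=> Df; elim/big_rec: _ => [|j g Pj Dg]; first exact: decomp_with0.
by apply: decomp_withD => //; exact: Df.
Qed.
End DecompWith.

(** The polynomial [|x|^2]. *)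
Definition sqnorm : mpoly n R := qpoly (1%:M, 0, 0).

Local Notation psd_decomp := (decomp_with (@psd R n)).

Lemma qpoly_psd_decomp k P v c : psd P ->
  psd_decomp (bmul R k * qpoly (P, v, c)).
Proof. by move=> Pp; apply: decomp_with_block => //; exact: psd0. Qed.

Lemma psd_decompD f g : psd_decomp f -> psd_decomp g -> psd_decomp (f + g).
Proof. by apply: decomp_withD; exact: psdD. Qed.

(** [- x_c^2 = x_c (1 - x_c) * 1 + 1 * (- x_c)], with zero matrices. *)
Lemma psd_decompNsqnorm : psd_decomp (- sqnorm).
Proof.
rewrite /sqnorm qpoly_mx -sumrN.
apply: decomp_with_sum => [||c _]; [exact: psd0|exact: psdD|].
rewrite (bigD1 c) //= mxE eqxx scale1r big1 ?addr0 => [|a ac]; last first.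
  by rewrite mxE eq_sym (negbTE ac) scale0r.
have -> : - (mvar R c * mvar R c)
   = bmul R (blk_xy (c, c)) * qpoly (0, 0, 1)
     + bmul R (blk_1 n) * qpoly (0, - delta_mx c 0, 0).
  rewrite qpoly_cst qpoly_vec (bigD1 c) //= !mxE !eqxx scaleN1r.
  rewrite big1 ?addr0 => [|a ac]; last first.
    by rewrite !mxE (negbTE ac) oppr0 scale0r.
  by rewrite /mul_xy mpolyC1; ring.
by apply: psd_decompD; apply: qpoly_psd_decomp; exact: psd0.
Qed.

(** If [h = g - g'], where [g'] is a multiplier and [- g |x|^2] is already
decomposed, then [- h |x|^2 = - g |x|^2 + g' |x|^2].  This reaches
[x_i] and [1 - x_i] from [1], and the products of degree 2 from these. *)
Lemma psd_decompNblock k : psd_decomp (- (bmul R k * sqnorm)).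
Proof.
have flip g g' h : psd_decomp (- (g * sqnorm)) -> h = g - g' ->
    psd_decomp (g' * sqnorm) -> psd_decomp (- (h * sqnorm)).
  move=> Ng -> Pg'; have -> : - ((g - g') * sqnorm)
    = - (g * sqnorm) + g' * sqnorm by ring.
  exact: psd_decompD.
have pos j : psd_decomp (bmul R j * sqnorm).
  by apply: qpoly_psd_decomp; exact: psd1.
have N1 : psd_decomp (- (1 * sqnorm)).
  by rewrite mul1r; exact: psd_decompNsqnorm.
have Nx i : psd_decomp (- (mvar R i * sqnorm)).
  by apply: flip N1 _ (pos (blk_y i)); rewrite /= /mul_y; ring.
have Ny i : psd_decomp (- ((1 - mvar R i) * sqnorm)).
  by apply: flip N1 _ (pos (blk_x i)).
move: k; apply: forall_block => /= [ij|i j|ij|i|i|].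
- apply: flip (Nx (val ij).1) _ (pos (blk_xy (val ij))).
  by rewrite /= /mul_xx /mul_xy; ring.
- rewrite /mul_xy; have [ij|ji] := leqP i j.
    apply: flip (Nx i) _ (pos (blk_xx (exist _ (i, j) ij))).
    by rewrite /= /mul_xx /=; ring.
  apply: flip (Nx i) _ (pos (blk_xx (exist _ (j, i) (ltnW ji)))).
  by rewrite /= /mul_xx /=; ring.
- apply: flip (Ny (val ij).2) _ (pos (blk_xy (val ij))).
  by rewrite /= /mul_yy /mul_xy; ring.
- exact: Nx.
- exact: Ny.
- exact: N1.
Qed.

Local Notation sym_decomp := (decomp_with [set P : 'M[R]_n | P^T = P]).

Lemma qpoly_sym_decomp k q : (qmat q)^T = qmat q ->
  sym_decomp (bmul R k * qpoly q).
Proof. by move=> qs; apply: decomp_with_block => //=; rewrite trmx0. Qed.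

Lemma mnm_split (m : multinom n) : mdeg m != 0%N ->
  exists i m', m = mnm_add (mnm1 i) m' /\ mdeg m = (mdeg m').+1.
Proof.
move=> m0; have [/existsP[i mi]|] := boolP [exists i, m i != 0%N]; last first.
  rewrite negb_exists => /forallP m_eq0; case/negP: m0.
  by rewrite mdegE big1 // => i _; exact/eqP/negbNE.
exists i, (mnm_sub m (mnm1 i)).
have mE : m = mnm_add (mnm1 i) (mnm_sub m (mnm1 i)).
  by rewrite addmC submK // lep1mP.
by split=> //; rewrite {1}mE mdegD mdeg1.
Qed.

Lemma qpoly_delta i j : qpoly (delta_mx i j, 0, 0) = mvar R i * mvar R j.
Proof.
rewrite qpoly_mx (bigD1 i) //= (bigD1 j) //= mxE !eqxx scale1r.
rewrite big1 => [|b bj]; last by rewrite mxE (negbTE bj) andbF scale0r.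
rewrite addr0 big1 ?addr0 // => a ai; rewrite big1 // => b _.
by rewrite mxE (negbTE ai) scale0r.
Qed.

Lemma qpoly_monomial (m : multinom n) : (mdeg m <= 2)%N ->
  exists2 q : qspace, (qmat q)^T = qmat q & mpolyX R m = qpoly q.
Proof.
have [/eqP|m0] := eqVneq (mdeg m) 0%N.
  rewrite mdeg_eq0 => /eqP -> _; exists (0, 0, 1); rewrite /= ?trmx0 //.
  by rewrite qpoly_cst mpolyX0 mpolyC1.
have [i [m' [-> ->]]] := mnm_split m0; rewrite ltnS mpolyXD.
have [/eqP|m'0] := eqVneq (mdeg m') 0%N.
  rewrite mdeg_eq0 => /eqP -> _; exists (0, delta_mx i 0, 0).
    by rewrite /= trmx0.
  rewrite qpoly_vec (bigD1 i) //= mxE !eqxx scale1r mpolyX0 mulr1.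
  by rewrite big1 ?addr0 // => a ai; rewrite mxE (negbTE ai) scale0r.
have [j [m'' [-> ->]]] := mnm_split m'0; rewrite ltnS leqn0 mpolyXD mdeg_eq0.
move=> /eqP ->; rewrite mpolyX0 mulr1.
(* The matrix of x_i x_j has to be symmetric. *)
exists (2^-1 *: (((delta_mx i j, 0, 0) : qspace) + (delta_mx j i, 0, 0))).
  by rewrite /= linearZ linearD /= !trmx_delta addrC.
rewrite qpolyZ qpolyD !qpoly_delta (mulrC (mvar R j)) -[X in X + _]scale1r.
rewrite -[X in _ + X]scale1r -scalerDl scalerA.
by rewrite mulVf ?pnatr_eq0 // scale1r.
Qed.

Lemma monomial_sym_decomp (m : multinom n) : (mdeg m <= 4)%N ->
  sym_decomp (mpolyX R m).
Proof.
have small (m' : multinom n) : (mdeg m' <= 2)%N -> sym_decomp (mpolyX R m').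
  move=> /qpoly_monomial[q qs ->]; rewrite -[qpoly q]mul1r.
  exact: (qpoly_sym_decomp (blk_1 n)).
have [m2 _|m2 m4] := leqP (mdeg m) 2; first exact: small.
have m0 : mdeg m != 0%N by rewrite -lt0n (leq_trans _ m2).
move: m2 m4; have [i [m' [-> ->]]] := mnm_split m0; rewrite !ltnS => m2 m4.
have m'0 : mdeg m' != 0%N by rewrite -lt0n (leq_trans _ m2).
move: m4; have [j [m'' [-> ->]]] := mnm_split m'0; rewrite ltnS.
move=> /qpoly_monomial[q qs qE]; rewrite !mpolyXD mulrA qE.
have [ij|ji] := leqP i j.
  exact: (qpoly_sym_decomp (blk_xx (exist _ (i, j) ij)) qs).
rewrite (mulrC (mpolyX R (mnm1 i))).
exact: (qpoly_sym_decomp (blk_xx (exist _ (j, i) (ltnW ji))) qs).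
Qed.

Lemma poly_sym_decomp p : (msize p <= 5)%N -> sym_decomp p.
Proof.
move=> p5; rewrite [p]mpolyE big_seq_cond.
apply: decomp_with_sum => [|A B /= As Bs|m]; first by rewrite /= trmx0.
  by rewrite linearD /= As Bs.
rewrite andbT => mp; apply: decomp_withZ => [A /= As|].
  by rewrite linearZ /= As.
by apply: monomial_sym_decomp; rewrite -ltnS (leq_trans (msize_mdeg_lt mp)).
Qed.

(** [P >= I] in the semidefinite order. *)
Definition ge1mx (P : 'M[R]_n) := P^T = P /\ forall v, dot v v <= qform P v.

Lemma ge1mx_psd P : ge1mx P -> psd P.
Proof.
by move=> [Ps Pge]; split=> // v; exact: le_trans (dot_ge0 v) (Pge v).
Qed.

Lemma ge1mxD P M : ge1mx P -> psd M -> ge1mx (P + M).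
Proof.
move=> [Ps Pge] [Ms Mge]; split=> [|v]; first by rewrite linearD /= Ps Ms.
by rewrite qformDl (le_trans (Pge v)) // lerDl.
Qed.

(** Every symmetric matrix becomes [>= I] when a multiple of [I] is added. *)
Lemma ge1mx_shift P : P^T = P -> exists c, 0 <= c /\ ge1mx (P + c *: 1%:M).
Proof.
move=> Ps; have [c c0 cP] := qform_bound P; exists (c + 1).
split; first by rewrite addr_ge0.
split=> [|v]; first by rewrite linearD /= Ps linearZ /= trmx1.
by rewrite qformDl qformZl qform1; have /ler_normlP[] := cP v; lra.
Qed.

(** Matrices [>= I] lie in the interior of the cone of psd matrices. *)
Lemma ge1mx_interior M : psd M -> exists2 c, 0 <= c &
  forall P e, ge1mx P -> 0 <= e -> e * c <= 1 ->
    psd ((1 + e) *: P + (1 - (1 + e)) *: M).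
Proof.
move=> [Ms _]; have [c c0 cM] := qform_bound M; exists c => //.
move=> P e [Ps Pge] e0 ec.
split=> [|v]; first by rewrite linearD /= !linearZ /= Ps Ms.
rewrite qformDl !qformZl.
have : e * qform M v <= dot v v.
  apply: le_trans (ler_wpM2l e0 (ler_norm _)) _.
  apply: le_trans (ler_wpM2l e0 (cM v)) _.
  by rewrite mulrA ler_piMl ?dot_ge0.
have : 0 <= e * qform P v by rewrite mulr_ge0 // (le_trans (dot_ge0 v)).
have := Pge v; move: (qform _ _) (qform _ _) (dot _ _) => x y w; lra.
Qed.

(** Slater point: to a decomposition of [p] into symmetric matrices add, in
each block, a large multiple of [|x|^2], and compensate it by psd matrices. *)
Lemma poly_definite_decomp p : (msize p <= 5)%N -> decomp_with ge1mx p.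
Proof.
move=> /poly_sym_decomp[F Fsym pE].
have /choice[c hc] : forall k, exists c,
    0 <= c /\ ge1mx (qmat (F k) + c *: 1%:M).
  by move=> k; apply: ge1mx_shift; exact: Fsym.
have [G Gpsd GE] : psd_decomp (\sum_k c k *: - (bmul R k * sqnorm)).
  apply: decomp_with_sum => [||k _]; [exact: psd0|exact: psdD|].
  have [c0 _] := hc k; apply: decomp_withZ; last exact: psd_decompNblock.
  by move=> A; exact: psdZ.
pose N : family := [ffun k => c k *: ((1%:M, 0, 0) : qspace)].
have NE k : N k = c k *: ((1%:M, 0, 0) : qspace) by rewrite ffunE.
exists (F + N + G) => [k|].
  have [_ FN] := hc k.
  by rewrite !familyD NE !qmatD qmatZ; exact: ge1mxD FN (Gpsd k).
(* The contributions of N and G cancel block by block. *)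
rewrite !decompD -pE -GE -[LHS]addr0 -addrA; congr (_ + _).
rewrite /decomp -big_split big1 //= => k _.
by rewrite NE qpolyZ -scalerAr scalerN subrr.
Qed.

End Slater.

(** * Duality in one block *)

Section BlockDuality.
Variables (R : realType) (n : nat).
Implicit Types (t : R) (v : 'cV[R]_n) (q : quadratic R n) (g : mpoly n R).
Implicit Types (lam : 'cV[R]_(nb_eqs n)).

(** The objective term of a block, as a linear function of [q].  It agrees with
[obj_term] unless [t = 0] and [v <> 0]; at [t = 0] it uses [0^-1 = 0]. *)
Definition lin_term t v q : R :=
  t^-1 * qform (qmx q) v + (dot v (qvec q) + t * qcst q).

Lemma obj_termE t v q : (t = 0 -> v = 0) ->
  obj_term t v q = (lin_term t v q)%:E.
Proof.
move=> tv; rewrite /obj_term /perspective /lin_term.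
have [t0|//] := eqVneq t 0.
by rewrite t0 (tv t0) qform0 eqxx mulr0 add0e add0r.
Qed.

Lemma obj_term_neqNy t v q : obj_term t v q != -oo%E.
Proof. by rewrite /obj_term /perspective; case: ifP => // _; case: ifP. Qed.

Lemma obj_term_eqy v q : qform (qmx q) v != 0 -> obj_term 0 v q = +oo%E.
Proof. by move=> qv; rewrite /obj_term /perspective eqxx (negbTE qv). Qed.

Lemma sum_data_pairing lam g q :
  \sum_l lam l 0 * data_pairing g l q
  = inner (\sum_l lam l 0 *: data_mx g l) (qmx q)
    + dot (\sum_l lam l 0 *: data_vec g l) (qvec q)
    + (\sum_l lam l 0 * data_cst g l) * qcst q.
Proof.
rewrite inner_suml dot_suml mulr_suml -!big_split /=; apply: eq_bigr => l _.
by rewrite innerZl dotZl /data_pairing; ring.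
Qed.

(** Weak duality in one block. *)
Lemma dual_block_bound lam g Y v t q : psd (qmx q) -> dual_block lam g Y v t ->
  (obj_term t v q <= (- \sum_l lam l 0 * data_pairing g l q)%:E)%E.
Proof.
move=> qpsd [YA vc tm Bpsd]; rewrite obj_termE; last exact: psd_block_vec0 Bpsd.
rewrite lee_fin sum_data_pairing /lin_term.
have -> : \sum_l lam l 0 *: data_vec g l = - v.
  by apply/eqP; rewrite -addr_eq0 addrC vc.
have -> : \sum_l lam l 0 * data_cst g l = - t.
  by apply/eqP; rewrite -addr_eq0 addrC tm.
have := inner_psd_ge0 YA qpsd; rewrite sub0r innerNl innerDl oppr_ge0.
have := inner_psd_ge0 (psd_block_schur Bpsd) qpsd.
rewrite innerDl innerNl innerZl (innerC (v *m _)) -qformE subr_ge0.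
by rewrite -[- v]scaleN1r dotZl; lra.
Qed.

Lemma data_mx_sym g l : (data_mx g l)^T = data_mx g l.
Proof. by apply/matrixP => a b; rewrite !mxE (mulrC (mvar R a)). Qed.

Lemma mul_le_bound (x c : R) : (forall r, 0 <= r -> r * x <= c) -> x <= 0.
Proof.
move=> h; rewrite leNgt; apply/negP => x0.
have c0 : 0 <= c by have := h 0 (lexx 0); rewrite mul0r.
have r0 : 0 <= (c + 1) / x by rewrite divr_ge0 ?addr_ge0 // ltW.
by have := h _ r0; rewrite divfK ?gt_eqF // gerDl ler10.
Qed.

(** Strong duality in one block: a nonpositive Lagrangian means dual
feasibility, with [Y = v v^T / t] as the matrix variable. *)
Lemma dual_block_of_bound lam g v t : 0 <= t -> (t = 0 -> v = 0) ->
  (forall q, psd (qmx q) ->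
     lin_term t v q + \sum_l lam l 0 * data_pairing g l q <= 0) ->
  dual_block lam g (t^-1 *: (v *m v^T)) v t.
Proof.
move=> t0 tv bnd.
have {}bnd P r c : psd P -> inner (t^-1 *: (v *m v^T)
      + \sum_l lam l 0 *: data_mx g l) P
    + dot (v + \sum_l lam l 0 *: data_vec g l) r
    + (t + \sum_l lam l 0 * data_cst g l) * c <= 0.
  move=> Ppsd; have := bnd (Quadratic P r c) Ppsd.
  rewrite sum_data_pairing /lin_term /= innerDl innerZl (innerC (v *m _)).
  rewrite -qformE.
  by rewrite dotDl mulrDl; congr (_ <= _); ring.
split; last exact: psd_block_outer.
- split=> [|a].
    rewrite sub0r linearN linearD /= linearZ /= outer_sym linear_sum /=.
    by under eq_bigr do rewrite linearZ /= data_mx_sym.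
  (* The bound at P = a a^T. *)
  rewrite sub0r qformE innerNl oppr_ge0.
  by have := bnd _ 0 0 (psd_outer a); rewrite dotC dot0l mulr0 !addr0.
- have := bnd 0 (v + \sum_l lam l 0 *: data_vec g l) 0 (@psd0 _ _).
  rewrite innerC -(scale0r (0 : 'M[R]_n)) innerZl mul0r add0r mulr0 addr0 => h.
  by apply: dot_eq0; apply/eqP; rewrite eq_le h dot_ge0.
- have := bnd 0 0 (t + \sum_l lam l 0 * data_cst g l) (@psd0 _ _).
  rewrite innerC -(scale0r (0 : 'M[R]_n)) innerZl mul0r add0r dotC dot0l add0r.
  rewrite -expr2 => h; apply/eqP; rewrite -sqrf_eq0 eq_le h; exact: sqr_ge0.
Qed.

End BlockDuality.

(** * Duality for the inner maximum *)

Lemma sum_lagrangian (R : comPzRingType) (K L : finType) (f : K -> R)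
    (a : L -> R) (m : K -> L -> R) :
  \sum_k (f k + \sum_l a l * m k l) = \sum_k f k + \sum_l a l * \sum_k m k l.
Proof.
rewrite big_split exchange_big; congr (_ + _); apply: eq_bigr => l _.
by rewrite mulr_sumr.
Qed.

Section Duality.
Variables (R : realType) (n : nat) (p4 : mpoly n R).
Implicit Types (z : triple R n) (Z : coefs R n) (d : dual_vars R n).
Implicit Types (F : family R n).

(** The constraints of the dual problem other than the membership of [z] in the
region. *)
Definition feasible_at z d := forall k : block n,
  dual_block (dlam d) (bmul R k) (bdual d k) (bvec z k) (bcst z k).

Lemma sum_eq_lhs (lam : 'cV[R]_(nb_eqs n)) Z :
  \sum_l lam l 0 * eq_lhs l Z
  = \sum_k \sum_l lam l 0 * data_pairing (bmul R k) l (bcoef Z k).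
Proof.
rewrite exchange_big; apply: eq_bigr => l _.
by rewrite eq_lhsE mulr_sumr.
Qed.

Lemma weak_duality z d : feasible_at z d ->
  (inner_max p4 z <= (sdp_obj p4 (z, d))%:E)%E.
Proof.
move=> zd; apply: ge_ereal_sup => _ [Z [Zeq /psd_coefsE Zpsd] <-].
rewrite g4E /sdp_obj /=.
have -> : \sum_l dlam d l 0 * eq_rhs p4 l = \sum_l dlam d l 0 * eq_lhs l Z.
  by apply: eq_bigr => l _; rewrite Zeq.
rewrite sum_eq_lhs -sumrN -sumEFin; apply: lee_sum => k _.
exact: dual_block_bound.
Qed.

(** A family as a collection [Z]. *)
Definition coefs_family F : coefs R n := coefs_of (fun k => quad (F k)).

Lemma bcoef_family F k : bcoef (coefs_family F) k = quad (F k).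
Proof. exact: (coefs_ofK (fun k => quad (F k))). Qed.

Hypothesis deg_p4 : (msize p4 <= 5)%N.

Lemma coefs_family_Vset F : (forall k, psd (qmat (F k))) ->
  (forall l, eq_lhs l (coefs_family F) = eq_rhs p4 l) ->
  Vset p4 (coefs_family F).
Proof.
move=> Fpsd Feq; split=> //; apply/psd_coefsE => k; rewrite bcoef_family.
exact: Fpsd.
Qed.

Lemma slater_point : exists2 F : family R n, (forall k, ge1mx (qmat (F k)))
  & forall l, eq_lhs l (coefs_family F) = eq_rhs p4 l.
Proof.
have [F Fge pE] := poly_definite_decomp deg_p4; exists F => //.
apply/decompositionP => //; rewrite decomposition_polyE pE.
by apply: eq_bigr => k _; rewrite bcoef_family.
Qed.

Lemma g4_neqNy z Z : g4 z Z != -oo%E.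
Proof.
rewrite g4E; apply/negP => /eqP/esum_eqNyP[k [_ _ /eqP]].
by rewrite (negbTE (obj_term_neqNy _ _ _)).
Qed.

Lemma inner_max_neqNy z : inner_max p4 z != -oo%E.
Proof.
have [F Fge Feq] := slater_point.
have FV := coefs_family_Vset (fun k => ge1mx_psd (Fge k)) Feq.
have : (g4 z (coefs_family F) <= inner_max p4 z)%E.
  by apply: ereal_sup_ubound; exists (coefs_family F).
by apply: contraTneq => ->; rewrite leeNy_eq g4_neqNy.
Qed.

(** Otherwise the term of block [k] is infinite at the Slater point, whose
matrix in that block is definite. *)
Lemma inner_max_lty_vec z k : inner_max p4 z != +oo%E ->
  bcst z k = 0 -> bvec z k = 0.
Proof.
have [F Fge Feq] := slater_point.
have FV := coefs_family_Vset (fun k => ge1mx_psd (Fge k)) Feq.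
move=> fin t0; apply: contrapT => /eqP v0; case/negP: fin.
rewrite -leye_eq; apply: (@le_trans _ _ (g4 z (coefs_family F))); last first.
  by apply: ereal_sup_ubound; exists (coefs_family F).
rewrite leye_eq g4E esum_eqy => [|j _]; last exact: obj_term_neqNy.
apply/existsP; exists k; rewrite /= t0 obj_term_eqy // bcoef_family gt_eqF //.
apply: lt_le_trans (proj2 (Fge k) _); rewrite lt_neqAle dot_ge0 andbT eq_sym.
by apply: contra_neq v0 => /dot_eq0.
Qed.

Definition psd_family : set (family R n) :=
  [set F | forall k, psd (qmat (F k))].

Lemma psd_family_convex : convex_subset psd_family.
Proof.
move=> a F G /andP[a0 a1] Fpsd Gpsd k; rewrite familyD !familyZ qmatD !qmatZ.
by apply: psdD; apply: psdZ => //; rewrite subr_ge0.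
Qed.

Lemma psd_family_relint F : (forall k, ge1mx (qmat (F k))) ->
  relint_point psd_family F.
Proof.
move=> Fge; split=> [k|G Gpsd]; first exact: ge1mx_psd.
have /choice[c hc] : forall k, exists c, 0 <= c /\
    forall P e, ge1mx P -> 0 <= e -> e * c <= 1 ->
      psd ((1 + e) *: P + (1 - (1 + e)) *: (qmat (G k))).
  by move=> k; have [c ? ?] := ge1mx_interior (Gpsd k); exists c.
pose C := 1 + \sum_k c k.
have C0 : 0 < C.
  by rewrite ltr_wpDr // sumr_ge0 // => k _; case: (hc k).
exists (1 + C^-1) => [|k]; first by rewrite ltrDl invr_gt0.
rewrite familyD !familyZ qmatD !qmatZ; have [ck cG] := hc k.
apply: cG => //; first by rewrite invr_ge0 ltW.
rewrite mulrC ler_pdivrMr // mul1r /C (bigD1 k) //= addrCA lerDl.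
by rewrite addr_ge0 // sumr_ge0 // => j _; case: (hc j).
Qed.

Lemma lin_term_affine t v :
  affine (fun q : qspace R n => lin_term t v (quad q)).
Proof.
move=> a x y; rewrite /lin_term /= qformDl !qformZl dotDr !dotZr.
change (a *: x.2 + (1 - a) *: y.2) with (a * x.2 + (1 - a) * y.2).
by ring.
Qed.

Lemma data_pairing_affine g l :
  affine (fun q : qspace R n => data_pairing g l (quad q)).
Proof.
move=> a x y; rewrite /data_pairing /= innerDr !innerZr dotDr !dotZr.
change (a *: x.2 + (1 - a) *: y.2) with (a * x.2 + (1 - a) * y.2).
by ring.
Qed.

Lemma lin_termZ t v c (q : qspace R n) :
  lin_term t v (quad (c *: q)) = c * lin_term t v (quad q).
Proof.
rewrite /lin_term /= qformZl dotZr.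
by change (c *: q.2) with (c * q.2); ring.
Qed.

Lemma data_pairingZ g l c (q : qspace R n) :
  data_pairing g l (quad (c *: q)) = c * data_pairing g l (quad q).
Proof.
rewrite /data_pairing /= innerZr dotZr.
by change (c *: q.2) with (c * q.2); ring.
Qed.

Lemma sum_affine (f : block n -> qspace R n -> R) :
  (forall k, affine (f k)) -> affine (fun F : family R n => \sum_k f k (F k)).
Proof.
move=> fa a x y; rewrite !mulr_sumr -big_split; apply: eq_bigr => k _.
by rewrite familyD !familyZ fa.
Qed.

Lemma strong_duality z : (forall k, 0 <= bcst z k) ->
  inner_max p4 z != +oo%E ->
  exists2 d, feasible_at z d & ((sdp_obj p4 (z, d))%:E <= inner_max p4 z)%E.
Proof.
move=> t0 fin; have tv k := inner_max_lty_vec (k := k) fin.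
have sE : (fine (inner_max p4 z))%:E = inner_max p4 z.
  by rewrite fineK // fin_numE inner_max_neqNy.
set s := fine _ in sE.
have [F0 F0ge F0eq] := slater_point.
pose f F := \sum_k lin_term (bcst z k) (bvec z k) (quad (F k)).
pose e (l : 'I_(nb_eqs n)) F :=
  \sum_k data_pairing (bmul R k) l (quad (F k)) - eq_rhs p4 l.
have eE l F : e l F = eq_lhs l (coefs_family F) - eq_rhs p4 l.
  rewrite eq_lhsE; congr (_ - _); apply: eq_bigr => k _.
  by rewrite bcoef_family.
have [||||c hc] := @lagrange_multipliers _ _ _ F0 _ e f s
    psd_family_convex (psd_family_relint F0ge).
- exact: (sum_affine (fun k => @lin_term_affine (bcst z k) (bvec z k))).
- move=> l a F G.
  have := sum_affine (fun k => data_pairing_affine (bmul R k) l).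
  by rewrite /affine /e => ->; ring.
- by move=> l; rewrite eE F0eq subrr.
- move=> F Fpsd Feq; rewrite -lee_fin sE.
  have <- : g4 z (coefs_family F) = (f F)%:E.
    rewrite g4E /f -sumEFin; apply: eq_bigr => k _.
    by rewrite bcoef_family obj_termE //; exact: tv.
  apply: ereal_sup_ubound; exists (coefs_family F) => //.
  apply: coefs_family_Vset => // l; apply/eqP; rewrite -subr_eq0 -eE.
  exact/eqP/Feq.
pose lam : 'cV[R]_(nb_eqs n) := \col_l c l.
pose L k q := lin_term (bcst z k) (bvec z k) (quad q)
  + \sum_l lam l 0 * data_pairing (bmul R k) l (quad q).
have {}hc F : (forall k, psd (qmat (F k))) ->
    \sum_k L k (F k) <= s + \sum_l lam l 0 * eq_rhs p4 l.
  move=> /hc; rewrite /L sum_lagrangian -lerBlDr; apply: le_trans.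
  rewrite -addrA lerD2l -sumrB; apply: ler_sum => l _.
  by rewrite mxE -mulrBr.
(* L k is homogeneous and bounded above on a cone, hence nonpositive there. *)
have LZ k r q : L k (r *: q) = r * L k q.
  rewrite /L lin_termZ [RHS]mulrDr mulr_sumr; congr (_ + _).
  by apply: eq_bigr => l _; rewrite data_pairingZ mulrCA.
have L0 k : L k 0 = 0 by rewrite -(scale0r (0 : qspace R n)) LZ mul0r.
pose d := dual_of (fun k => (bcst z k)^-1 *: (bvec z k *m (bvec z k)^T)) lam.
exists d => [k|].
  rewrite /d dual_ofK; apply: dual_block_of_bound => // [|q qpsd].
    exact: tv.
  apply: mul_le_bound => r r0.
  pose Q : qspace R n := (qmx q, qvec q, qcst q).
  have -> : r * (lin_term (bcst z k) (bvec z k) q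
      + \sum_l lam l 0 * data_pairing (bmul R k) l q) = L k (r *: Q).
    by rewrite LZ /L /Q; case: (q).
  (* The family that is r Q in block k and zero elsewhere. *)
  have := hc [ffun j => if j == k then r *: Q else 0].
  rewrite (bigD1 k) //= ffunE eqxx big1 ?addr0 => [|j jk]; last first.
    by rewrite ffunE (negbTE jk) L0.
  apply=> j; rewrite ffunE; case: ifP => _; last exact: psd0.
  exact: psdZ.
(* The zero family bounds the dual objective by s. *)
have := hc 0; rewrite big1 => [|k _]; last by rewrite family0 L0.
rewrite -sE lee_fin /sdp_obj /= -lerBlDr sub0r; apply=> k.
by rewrite family0; exact: psd0.
Qed.

(** [g4] at the lift of [x] equals [p4 x], whatever the decomposition. *)
Lemma inner_max_lift (x : 'cV[R]_n) : (forall i, 0 <= x i 0 <= 1) ->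
  inner_max p4 (lift_point x) != +oo%E.
Proof.
move=> x01; pose ev : {rmorphism mpoly n R -> R} := meval (fun i => x i 0).
have evX i : ev (mvar R i) = x i 0 by exact: mevalXU.
have bE k : [/\ bcst (lift_point x) k = ev (bmul R k),
    bvec (lift_point x) k = ev (bmul R k) *: x & 0 <= ev (bmul R k)].
  have col_lift i : col i (x *m x^T) = x i 0 *: x.
    by apply/colP => a; rewrite !mxE big_ord1 !mxE mulrC.
  have U_lift i j : (x *m x^T) i j = x i 0 * x j 0.
    by rewrite !mxE big_ord1 !mxE.
  have x0 i : 0 <= x i 0 by case/andP: (x01 i).
  have x1 i : 0 <= 1 - x i 0 by rewrite subr_ge0; case/andP: (x01 i).
  move: k; apply: forall_block => /= [ij|i j|ij|i|i|].
  - rewrite /mul_xx rmorphM !evX /tv /= ffunE U_lift; split => //.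
    exact: mulr_ge0.
  - rewrite /mul_xy rmorphM rmorphB rmorph1 !evX /tv /= ffunE U_lift col_lift.
    rewrite /tx /= -scalerBl; split; [ring| |exact: mulr_ge0].
    by congr (_ *: _); ring.
  - rewrite /mul_yy rmorphM !rmorphB rmorph1 !evX /theta /theta_cst.
    rewrite /tv /= ffunE.
    rewrite /tx /tU /= U_lift !col_lift; split; [ring| |exact: mulr_ge0].
    by apply/colP => a; rewrite !mxE; ring.
  - by rewrite /mul_x evX col_lift.
  - rewrite /mul_y rmorphB rmorph1 evX col_lift /tx /=; split=> //.
    by apply/colP => a; rewrite !mxE; ring.
  - by rewrite rmorph1 scale1r.
have evq q : ev (quadratic_poly q) = qform (qmx q) x + dot x (qvec q) + qcst q.
  rewrite /quadratic_poly !rmorphD /=; congr (_ + _ + _).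
  - rewrite qformE innerE rmorph_sum; apply: eq_bigr => a _.
    rewrite rmorph_sum; apply: eq_bigr => b _.
    by rewrite !mxE big_ord1 !mxE [ev _]mevalZ rmorphM !evX.
  - rewrite rmorph_sum dotE; apply: eq_bigr => a _.
    by rewrite [ev _]mevalZ evX mulrC.
  - exact: mevalC.
suff h : forall Z, Vset p4 Z -> g4 (lift_point x) Z = (ev p4)%:E.
  rewrite -ltey; apply: (@le_lt_trans _ _ (ev p4)%:E); last exact: ltry.
  by apply: ge_ereal_sup => _ [Z ZV <-]; rewrite h.
move=> Z [/(decompositionP Z deg_p4) pE _].
rewrite g4E {1}pE decomposition_polyE rmorph_sum -sumEFin.
apply: eq_bigr => k _.
have [-> -> e0] := bE k; rewrite rmorphM evq.
rewrite obj_termE => [|->]; last by rewrite scale0r.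
rewrite /lin_term; congr EFin; move: (ev (bmul R k)) e0 => c c0.
rewrite dotZl qformZr.
have [->|cn0] := eqVneq c 0; first by rewrite !mul0r invr0 mul0r !addr0.
by field.
Qed.

End Duality.

Theorem theorem5 (R : realType) (n p K : nat)
    (p4 : mpoly n R)
    (A : 'M[R]_(p, n)) (b : 'cV[R]_p) (h : 'I_K -> 'cV[R]_n -> \bar R)
    (I : Type) (C : I -> set (triple R n))
    (Xbar := lifted_region A b h C)
    (deg_p4 : msize p4 = 5%N)
    (h_pcc : forall k, [/\ proper_fun (h k), closed_fun (h k)
                         & convex_fun (h k)])
    (X_box : forall x, Xset A b h x -> forall i, 0 <= x i 0 <= 1)
    (Xbar_convex : convex_region Xbar)
    (Xbar_lift : forall x, Xset A b h x -> Xbar (lift_point x))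
    (Xbar_box : box_products_nonneg Xbar)
    (z : triple R n) :
  optimal_solution Xbar (inner_max p4) z
  <-> exists d : dual_vars R n,
        optimal_solution (sdp_feasible Xbar) (sdp_obj p4) (z, d).
Proof.
have p5 : (msize p4 <= 5)%N by rewrite deg_p4.
have t_ge0 y : Xbar y -> forall k, 0 <= bcst y k.
  move=> Xy; have [Xx _ _ _ _] := Xy; have x01 := X_box _ Xx.
  apply: forall_block => /= [ij|i j|ij|i|i|].
  - by have [] := Xbar_box _ Xy (val ij).1 (val ij).2.
  - by have [] := Xbar_box _ Xy i j.
  - by have [] := Xbar_box _ Xy (val ij).1 (val ij).2.
  - by case/andP: (x01 i).
  - by rewrite subr_ge0; case/andP: (x01 i).
  - exact: ler01.
split=> [[Xz zopt]|[d [/sdp_feasibleE[Xz zd] dopt]]].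
  (* The lift of the x-part of z competes with z and has a finite value. *)
  have fin : inner_max p4 z != +oo%E.
    have [Xx _ _ _ _] := Xz.
    have := inner_max_lift p5 (X_box _ Xx); rewrite -!ltey; apply: le_lt_trans.
    exact/zopt/Xbar_lift.
  have [d zd dle] := strong_duality p5 (t_ge0 _ Xz) fin.
  exists d; split; first exact/sdp_feasibleE.
  move=> [y e] /sdp_feasibleE[Xy ye]; rewrite -lee_fin.
  exact: le_trans dle (le_trans (zopt _ Xy) (weak_duality p4 ye)).
split=> // y Xy; have [->|fin] := eqVneq (inner_max p4 y) +oo%E.
  exact: leey.
have [e ye ele] := strong_duality p5 (t_ge0 _ Xy) fin.
apply: le_trans (weak_duality p4 zd) (le_trans _ ele).
by rewrite lee_fin; apply/dopt/sdp_feasibleE.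
Qed.
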